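(* For a $\overleftrightarrow{\mathrm{mid}}$-convex $G_\delta$-set $A$ in a Polish group $X$ the following conditions are equivalent: (1) $A-A$ is not a neighborhood of zero in $X$; (2) $A-A$ is meager in $X$; (3) $A$ is generically Haar-$1$; (4) $A$ is Haar-thin; (5) $A$ is null-finite; (6) $A$ is Haar-scattered; (7) $A$ is Haar-countable.
   Context: All groups are Abelian, written additively; a Polish group is a topological group whose underlying space is Polish. $\mathbb N=\{1,2,\dots\}$. For $c\in X$ put $\frac12c:=\{x\in X:x+x=c\}$. A subset $A\subset X$ is mid-convex if $\emptyset\ne\frac12(a+b)\subset A$ for all $a,b\in A$. $A$ is $\overleftrightarrow{\mathrm{mid}}$-convex if it is mid-convex and for any points $a,b\in A$ and any neighborhood $U\subset A$ of $a$ in $A$ there exists $x\in U$ such that $2^n(x-a)=b-a$ for some $n\in\mathbb N$. Smallness notions for $A\subset X$ ($2^\omega=\{0,1\}^\omega$ is the Cantor cube). Generically Haar-$1$: the set $\{f\in C(2^\omega,X):\forall x\in X\;|f^{-1}(A+x)|\le1\}$ is comeager in the space $C(2^\omega,X)$ of continuous maps with the compact-open topology. Haar-thin: there is a continuous $f:2^\omega\to X$ such that for every $x\in X$ the set $f^{-1}(A+x)$ is thin, where $T\subset2^\omega$ is thin if for every $n\in\omega$ the map $T\ni x\mapsto x|_{\omega\setminus\{n\}}$ is injective. Null-finite: there is a continuous map $f:\omega+1\to X$ ($\omega+1$ with the order topology) such that $f^{-1}(A+x)$ is finite for every $x\in X$. Haar-scattered (resp. Haar-countable): there is a continuous map $f:2^\omega\to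 X$ such that $f^{-1}(A+x)$ is scattered, i.e. each of its nonempty subspaces has an isolated point (resp. countable), for every $x\in X$. *)

(* Defs.v *)
From HB Require Import structures.
From mathcomp Require Import all_boot all_order all_algebra.
From mathcomp Require Import all_classical all_reals all_analysis.

Set Implicit Arguments.
Unset Strict Implicit.
Unset Printing Implicit Defensive.

Import Order.TTheory GRing.Theory Num.Theory.

Local Open Scope classical_set_scope.
Local Open Scope ring_scope.

Definition separable (T : topologicalType) : Prop :=
  exists2 D : set T, countable D & dense D.

Definition homeomorphic (S T : topologicalType) : Prop :=
  exists (f : S -> T) (g : T -> S),
    [/\ cancel f g, cancel g f, continuous f & continuous g].

(* Completeness is spelled out because the structure [completeType] only
   covers pointed types. *)
Definition complete_uniform (T : uniformType) : Prop :=
  forall F : set_system T, ProperFilter F -> cauchy F ->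
    exists x : T, F --> x.

Definition completely_metrizable (R : realType) (T : topologicalType) : Prop :=
  exists M : metricType R, complete_uniform M /\ homeomorphic T M.

Definition polish (R : realType) (T : topologicalType) : Prop :=
  separable T /\ completely_metrizable R T.

Definition nowhere_dense (T : topologicalType) (A : set T) : Prop :=
  interior (closure A) = set0.

Definition meager (T : topologicalType) (A : set T) : Prop :=
  exists2 F : (set T)^nat,
    (forall n, nowhere_dense (F n)) & A `<=` \bigcup_n F n.

Definition comeager (T : topologicalType) (A : set T) : Prop := meager (~` A).

Definition scattered (T : topologicalType) (A : set T) : Prop :=
  forall S : set T, S `<=` A -> S !=set0 -> isolated S !=set0.

(* The ordinal omega + 1: [Some n] is the finite ordinal n, and [None] is the
   top element omega. *)
Definition omega_succ : Type := option nat.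

HB.instance Definition _ := Choice.on omega_succ.

Definition omega_succ_le (x y : omega_succ) : bool :=
  match x, y with
  | _, None => true
  | None, Some _ => false
  | Some m, Some n => (m <= n)%N
  end.

Definition omega_succ_lt (x y : omega_succ) : bool :=
  (y != x) && omega_succ_le x y.

Lemma omega_succ_le_anti : antisymmetric omega_succ_le.
Proof. by move=> [m|] [n|] //= /anti_leq ->. Qed.

Lemma omega_succ_le_trans : transitive omega_succ_le.
Proof. by move=> [n|] [m|] [p|] //=; exact: leq_trans. Qed.

Lemma omega_succ_le_total : total omega_succ_le.
Proof. by move=> [m|] [n|] //=; exact: leq_total. Qed.

Fact omega_succ_display : Order.disp_t.
Proof. exact: Order.default_display. Qed.

HB.instance Definition _ := Order.isOrder.Build omega_succ_display omega_succ
  (fun _ _ => erefl) (fun _ _ => erefl) (fun _ _ => erefl)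
  omega_succ_le_anti omega_succ_le_trans omega_succ_le_total.

Section AbelianGroup.
Context {X : zmodType}.
Implicit Types (A B : set X) (c x : X).

Definition half c : set X := [set x | x + x = c].

Definition translate A x : set X := [set a + x | a in A].

Definition diff_set A B : set X := [set a - b | a in A & b in B].

Definition mid_convex A : Prop :=
  forall a b, A a -> A b -> half (a + b) !=set0 /\ half (a + b) `<=` A.

End AbelianGroup.

Section TopologicalGroup.
Context {X : topologicalZmodType}.
Implicit Type A : set X.

(* [within A (nbhs a) U] says that U, a subset of A, is a neighborhood of a in
   the subspace A. *)
Definition lr_mid_convex A : Prop :=
  mid_convex A /\
  forall a b, A a -> A b ->
  forall U : set X, U `<=` A -> within A (nbhs a) U ->
  exists2 x, U x & exists2 n : nat, (0 < n)%N & (x - a) *+ (2 ^ n) = b - a.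

Section CompactOpen.
(* Endows [continuousType cantor_space X] with the compact-open topology. *)
Import ArrowAsCompactOpen.

Definition generically_haar1 A : Prop :=
  comeager [set f : continuousType cantor_space X |
    forall x, is_subset1 ((f : cantor_space -> X) @^-1` translate A x)].

End CompactOpen.

Definition thin (T : set cantor_space) : Prop :=
  forall n : nat, set_inj T (fun x : cantor_space => sigL (~` [set n]) x).

Definition haar_thin A : Prop :=
  exists2 f : cantor_space -> X, continuous f &
    forall x, thin (f @^-1` translate A x).

Definition null_finite A : Prop :=
  exists2 f : order_topology omega_succ -> X, continuous f &
    forall x, finite_set (f @^-1` translate A x).

Definition haar_scattered A : Prop :=
  exists2 f : cantor_space -> X, continuous f &
    forall x, scattered (f @^-1` translate A x).

Definition haar_countable A : Prop :=
  exists2 f : cantor_space -> X, continuous f &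
    forall x, countable (f @^-1` translate A x).

End TopologicalGroup.

(* Main.v *)
Require Import Defs.
From mathcomp Require Import all_boot all_order all_algebra.
From mathcomp Require Import all_classical all_reals all_analysis.
From mathcomp Require Import borel_hierarchy.

Set Implicit Arguments.
Unset Strict Implicit.
Unset Printing Implicit Defensive.


(** Write B for A - A. If f(s) and f(t) lie in the same translate of A, then
    f(s) - f(t) lies in B, so everything depends on how large B is.

    Suppose first that B is meager. Perturbing a map on the Cantor space to a
    locally constant one whose finitely many values have no difference in a
    given nowhere dense set shows that the maps f for which f(s) - f(t) avoids
    that set, for all s and t that differ before a given coordinate, contain a
    dense open set. Hence the generic f satisfies f(s) - f(t) \notin B for
    all s <> t ([meager_generically_haar1]). Since the space of maps is a Baire
    space, one such f exists ([generically_haar1_exists]). Its preimages of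
    translates of A have at most one point, and so f, or its composition with
    a convergent sequence, witnesses each of the other smallness notions.

    Suppose next that B is not meager. As A is lr-mid-convex, B is contained
    in the image of the doubling map x |-> 2x, which is therefore not meager;
    by an open mapping argument doubling is open at 0 ([doubling_open_at0]).
    By Lindelof there are b, c in A such that for all neighborhoods V of b and
    W of c the set S of the differences of A `&` V and A `&` W is not meager.
    S is a continuous image of a G_delta set, so that it is comeager in some
    nonempty open set ([heavy_part_image]) and S - S is a neighborhood of 0
    ([pettis]). If 2p = b + c, then averaging the representations
    2v = (x - y) - (x' - y') of the small vectors 2v shows that every small v
    is a difference of two points of A, the subtracted one near p
    ([local_difference]). In particular B is a neighborhood of 0.

    Suppose finally that B is a neighborhood of 0; by Baire it is not meager,
    and the previous paragraph applies. Given a continuous f, a point b and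
    parameters t_0, t_1, ... with b + f(t_k) in A for all k are built together
    ([translate_containing_sequence]): every new t_k is taken close to an
    earlier parameter of our choice, while b is corrected by smaller and
    smaller amounts. The corrections remain possible because in a vector space
    every point b + f(t_i) would be kept of the form (1 - 2^-n) e + 2^-n p with
    e in A; the predicate [room] expresses this without division. The
    corrected translations converge, and membership in A survives in the limit
    because A is a G_delta set. With all t_k chosen near the point omega this
    contradicts null-finiteness. With each t_i approximated infinitely often it
    gives a nonempty set without isolated points inside a preimage of a
    translate of A, which contradicts Haar-scatteredness; the preimage is a
    G_delta set, hence it is also uncountable. Haar-thinness fails more simply:
    changing a late coordinate of t changes f(t) by an element of B. *)

Import Order.TTheory GRing.Theory Num.Theory.

Local Open Scope classical_set_scope.
Local Open Scope ring_scope.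

(** * Complete sieves *)

(** A form of completeness that serves at once X, X * X, the Cantor space and
    the space of maps from the Cantor space to X: [small n] plays the role of
    the sets of diameter at most 1 / (n + 1). *)
Definition sieve_complete (T : topologicalType) : Prop :=
  exists small : nat -> set (set T),
    [/\ forall n V W, W `<=` V -> small n V -> small n W,
        forall n (x : T) U, nbhs x U ->
          exists V, [/\ open V, V x, closure V `<=` U & small n V] &
        forall V : nat -> set T, (forall n, V n !=set0) ->
          (forall n, V n.+1 `<=` V n) -> (forall n, small n (V n)) ->
          exists x : T, forall U, nbhs x U -> exists n, V n `<=` U].

(** Indexing by an arbitrary countable type lets a product of spaces have the
    product of the index types. *)
Definition countable_base (T : topologicalType) (I : countType)
    (B : I -> set T) : Prop :=
  (forall i, open (B i)) /\
  forall (x : T) U, nbhs x U -> exists2 i, B i x & B i `<=` U.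

Lemma decreasing_setsP (T : Type) (V : nat -> set T) :
  (forall n, V n.+1 `<=` V n) -> forall n m, (n <= m)%N -> V m `<=` V n.
Proof.
move=> Vdec n; elim=> [|m IH]; first by rewrite leqn0 => /eqP->.
rewrite leq_eqVlt => /predU1P[->//|nm]; apply: subset_trans (IH nm).
exact: Vdec.
Qed.

(** A play of the Banach-Mazur game: from a position (V, d) the player names
    a point x of V, a neighborhood W of x and new data d', and must cope with
    every open V' around x whose closure is inside W. Choosing V' small at each
    round makes the play converge to a point of all the V n. *)
Lemma sieve_strategy (T : topologicalType) (D : Type)
    (inv : nat -> set T -> D -> Prop) (rel : D -> D -> Prop)
    (V0 : set T) (d0 : D) :
  sieve_complete T -> inv 0%N V0 d0 ->
  (forall n V d, inv n V d -> exists x W d',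
    [/\ nbhs x W, W `<=` V, rel d d' &
        forall V', open V' -> V' x -> closure V' `<=` W -> inv n.+1 V' d']) ->
  exists (y : T) (V : nat -> set T) (d : nat -> D),
    [/\ forall n, inv n (V n) (d n), d 0%N = d0,
        forall n, rel (d n) (d n.+1),
        forall n, V n y &
        forall U, nbhs y U -> exists n, V n `<=` U].
Proof.
move=> [small [small_sub small_nbhs small_cvg]] inv0 step.
pose S := {s : nat * (set T * D) | inv s.1 s.2.1 s.2.2}.
pose next (s s' : S) := [/\ (sval s').1 = (sval s).1.+1,
  closure (sval s').2.1 `<=` (sval s).2.1, (sval s').2.1 !=set0,
  small (sval s).1 (sval s').2.1 & rel (sval s).2.2 (sval s').2.2].
have nextP (s : S) : {s' | next s s'}.
  apply: cid; case: s => -[n [V d]] /= invs.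
  have [x [W [d' [Wx WV rdd' ok]]]] := step n V d invs.
  have [V' [oV' V'x clV' smV']] := small_nbhs n x W Wx.
  exists (exist _ (n.+1, (V', d')) (ok V' oV' V'x clV')); split=> //=.
  - exact: subset_trans clV' WV.
  - by exists x.
have [s [s0 sS]] := dependent_choice nextP
  (exist (fun s => inv s.1 s.2.1 s.2.2) (0%N, (V0, d0)) inv0).
have sn n : (sval (s n)).1 = n.
  by elim: n => [|n IH]; [rewrite s0|have [-> _ _ _ _] := sS n; rewrite IH].
pose V n := (sval (s n)).2.1; pose d n := (sval (s n)).2.2.
have Vdec n : V n.+1 `<=` V n.
  by have [_ h _ _ _] := sS n; apply: subset_trans h; exact: subset_closure.
have Vdecm := decreasing_setsP Vdec.
have [y yV] : exists y : T, forall U, nbhs y U -> exists n, V n.+1 `<=` U.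
  apply: small_cvg => n; [|exact: Vdec|].
  - by have [_ _ h _ _] := sS n.
  - by have [_ _ _ h _] := sS n; rewrite sn in h.
exists y, V, d; split=> //.
- by move=> n; have := svalP (s n); rewrite sn.
- by rewrite /d s0.
- by move=> n; have [_ _ _ _ h] := sS n.
- move=> n; have [_ h _ _ _] := sS n; apply: h => U Uy.
  have [m VU] := yV U Uy.
  have [_ _ [z Vz] _ _] := sS (n + m)%N; exists z; split.
  + by apply: Vdecm Vz; rewrite ltnS leq_addr.
  + by apply: VU; apply: Vdecm Vz; rewrite ltnS leq_addl.
- by move=> U /yV[n VU]; exists n.+1.
Qed.

(** * Baire category *)

Section category.
Context {T : topologicalType}.
Implicit Types (A B U V : set T).

Lemma nowhere_denseP A : nowhere_dense A <->
  forall U, open U -> U !=set0 ->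
    exists (x : T) V, [/\ nbhs x V, V `<=` U & V `<=` ~` A].
Proof.
split=> [nd U oU [x Ux]|h].
  have : ~ U `<=` closure A.
    move=> UA; have : interior (closure A) x.
      by apply: filterS UA _; exact: open_nbhs_nbhs.
    by rewrite nd.
  move=> /existsNP[y /not_implyP[Uy nAy]].
  have oC : open (~` closure A) by apply: closed_openC; exact: closed_closure.
  exists y, (U `&` ~` closure A); split.
  - by apply: open_nbhs_nbhs; split=> //; exact: openI.
  - by move=> ? [].
  - by move=> z [_ nz] Az; apply: nz; exact: subset_closure.
rewrite /nowhere_dense -subset0 => x xA.
have [//||y [V [Vy VU VA]]] := h (interior (closure A)).
- exact: open_interior.
- by exists x.
have /VU/interior_subset/(_ _ Vy)[z [Az Vz]] : V y by exact: nbhs_singleton.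
exact: VA Vz Az.
Qed.

Lemma meagerS A B : A `<=` B -> meager B -> meager A.
Proof. by move=> AB [F ndF BF]; exists F => //; exact: subset_trans BF. Qed.

Lemma meager_bigcup (I : countType) (P : set I) (F : I -> set T) :
  (forall i, P i -> meager (F i)) -> meager (\bigcup_(i in P) F i).
Proof.
move=> mF; have /choice[G GP] : forall i, exists G : nat -> set T,
    (forall n, nowhere_dense (G n)) /\ (P i -> F i `<=` \bigcup_n G n).
  move=> i; have [/mF[G ndG FG]|nPi] := pselect (P i); first by exists G.
  exists (fun=> set0); split=> // n.
  by rewrite /nowhere_dense closure0 interior0.
exists (fun k => if unpickle k is Some (i, n) then G i n else set0).
  move=> k; case: unpickle => [[i n]|]; first by have [] := GP i.
  by rewrite /nowhere_dense closure0 interior0.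
move=> x [i Pi Fix]; have [_ /(_ Pi x Fix)[n _ Gx]] := GP i.
by exists (pickle (i, n)) => //; rewrite pickleK.
Qed.

Lemma nowhere_dense_meager A : nowhere_dense A -> meager A.
Proof. by move=> ndA; exists (fun=> A) => // x Ax; exists 0%N. Qed.

Lemma meager0 : meager (set0 : set T).
Proof.
by apply: nowhere_dense_meager; rewrite /nowhere_dense closure0 interior0.
Qed.

Lemma meagerU A B : meager A -> meager B -> meager (A `|` B).
Proof.
move=> mA mB; have := @meager_bigcup bool setT (fun b => if b then A else B).
move=> /(_ _)/meagerS; apply; last by case.
by move=> x [Ax|Bx]; [exists true|exists false].
Qed.

Theorem baire : sieve_complete T ->
  forall U, open U -> U !=set0 -> ~ meager U.
Proof.
move=> cT U oU [x0 Ux0] [F ndF UF].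
pose inv n V (_ : unit) := [/\ open V, V !=set0, V `<=` U &
  forall m, (m < n)%N -> V `&` F m = set0].
have [||y [V [d [invV _ _ Vy _]]]] :=
    @sieve_strategy T unit inv (fun _ _ => True) U tt cT.
- by split=> //; exists x0.
- move=> n V _ [oV V0 VU VF].
  have [x [W [Wx WV WF]]] := (nowhere_denseP (F n)).1 (ndF n) V oV V0.
  exists x, W, tt; split=> // V' oV' V'x.
  move=> /(subset_trans (@subset_closure _ _)) V'W.
  split=> //; [by exists x|by move=> z /V'W/WV/VU|].
  move=> m; rewrite ltnS leq_eqVlt => /predU1P[->|mn].
    by rewrite -subset0 => z [/V'W/WF].
  by rewrite -subset0 -(VF m mn) => z [/V'W/WV].
have [_ _ /(_ y (Vy 0%N))/UF[n _ Fny] _] := invV 0%N.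
have [_ _ _ /(_ n (ltnSn n))] := invV n.+1.
by rewrite -subset0 => /(_ y); apply; split=> //; exact: Vy.
Qed.

(** The largest open set in which A is everywhere non-meager. *)
Definition heavy_part A : set T :=
  \bigcup_(U in [set U | open U /\
    forall V, open V -> V !=set0 -> V `<=` U -> ~ meager (A `&` V)]) U.

Lemma open_heavy_part A : open (heavy_part A).
Proof. by apply: bigcup_open => U []. Qed.

Lemma heavy_part_nonmeager A U :
  open U -> U `&` heavy_part A !=set0 -> ~ meager (A `&` U).
Proof.
move=> oU [x [Ux [W [oW hW] Wx]]] m.
apply: (hW (U `&` W)).
- exact: openI.
- by exists x.
- by move=> ? [].
- by apply: meagerS m => z [Az [Uz _]].
Qed.

Lemma heavy_partS A B : A `<=` B -> heavy_part A `<=` heavy_part B.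
Proof.
move=> AB x [U [oU hU] Ux]; exists U => //; split=> // V oV V0 VU m.
by apply: (hU V) => //; apply: meagerS m => z [/AB].
Qed.

Lemma heavy_part_closure A : heavy_part A `<=` closure A.
Proof.
move=> x Ax U; rewrite nbhsE => -[V [oV Vx] VU].
have := @heavy_part_nonmeager A V oV (ex_intro _ x (conj Vx Ax)).
apply: contra_notP => AU0; suff -> : A `&` V = set0 by exact: meager0.
by rewrite -subset0 => z [Az /VU Uz]; apply: AU0; exists z.
Qed.

(** Banach category theorem with a countable base: otherwise the basic open
    sets in which A is meager would have a dense union Z, and A would be
    covered by its meager part in Z and the nowhere dense complement of Z. *)
Lemma heavy_part_neq0 (I : countType) (B : I -> set T) A :
  countable_base B -> ~ meager A -> heavy_part A !=set0.
Proof.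
move=> [oB bB]; apply: contra_notP => A0.
pose Z := \bigcup_(i in [set i | meager (A `&` B i)]) B i.
have mZ : meager (A `&` Z).
  by rewrite /Z setI_bigcupr; exact: meager_bigcup.
have ndZ : nowhere_dense (~` Z).
  apply/nowhere_denseP => U oU [x Ux].
  have : ~ (forall V, open V -> V !=set0 -> V `<=` U -> ~ meager (A `&` V)).
    by move=> h; apply: A0; exists x; exists U.
  move=> /existsNP[V /not_implyP[oV /not_implyP[[y Vy]]]].
  move=> /not_implyP[VU /contrapT mV].
  have [i Biy BiV] := bB y V (open_nbhs_nbhs (conj oV Vy)).
  exists y, (B i); split; first exact: open_nbhs_nbhs.
  - exact: subset_trans BiV VU.
  - rewrite setCK => z Bz; exists i => //=.
    by apply: meagerS mV => w [Aw /BiV].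
apply: meagerS (meagerU mZ (nowhere_dense_meager ndZ)) => z Az.
by have [Zz|nZz] := pselect (Z z); [left|right].
Qed.

End category.

Lemma meager_preimage (S T : topologicalType) (f : S -> T) (g : T -> S)
    (A : set T) :
  cancel f g -> cancel g f -> continuous f -> continuous g ->
  meager A -> meager (f @^-1` A).
Proof.
move=> fK gK cf cg [F ndF AF].
exists (fun n => f @^-1` F n) => [n|y]; last first.
  by move=> /AF[n _ Fn]; exists n.
apply/nowhere_denseP => U oU [x Ux].
have [||y [V [Vy VU VF]]] := (nowhere_denseP _).1 (ndF n) (g @^-1` U).
- by apply: open_comp => // ? _; exact: cg.
- by exists (f x) => /=; rewrite fK.
exists (g y), (f @^-1` V); split.
- by apply: cf; rewrite gK.
- by move=> z /VU /=; rewrite fK.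
- by move=> z /VF.
Qed.

(** Continuous images of G_delta sets have the Baire property, in the form
    needed here. For a basic open set B i put K i for the heavy part of the
    image of E `&` B i. Since E `&` B i is the union of its parts in the basic
    sets that are finer at level n, the heavy parts of the latter are dense in
    K i. So a point x of K None outside countably many nowhere dense sets
    lies in K (s n) for a sequence s of finer and finer basic sets; these
    shrink to a point of E, which is mapped to x. *)
Lemma heavy_part_image (P T : topologicalType) (I J : countType)
    (BP : I -> set P) (BT : J -> set T) (E : set P) (phi : P -> T) :
  sieve_complete P -> countable_base BP -> countable_base BT ->
  hausdorff_space T -> continuous phi -> Gdelta E ->
  meager (heavy_part (phi @` E) `\` phi @` E).
Proof.
move=> [small [small_sub small_nbhs small_cvg]] [oBP bBP] bBT hT cphi [Q oQ EQ].
(* The index None stands for the whole space, where the refinement starts. *)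
pose B (i : option I) := if i is Some j then BP j else setT.
have oB i : open (B i) by case: i => // ; exact: openT.
pose K i := heavy_part (phi @` (E `&` B i)).
pose finer n i i' := closure (BP i') `<=` B i `&` Q n /\ small n (BP i').
pose N n i := K i `\` \bigcup_(i' in finer n i) K (Some i').
have clK i : K i `<=` closure (phi @` (E `&` B i)) by exact: heavy_part_closure.
have ndN n i : nowhere_dense (N n i).
  apply/nowhere_denseP => U oU [x0 Ux0].
  have [UK|UK0] := pselect (U `&` K i !=set0); last first.
    exists x0, U; split=> //; first exact: open_nbhs_nbhs.
    by move=> z Uz [Kz _]; apply: UK0; exists z.
  have nm := heavy_part_nonmeager oU UK.
  have [j [fj nmj]] : exists j, finer n i j /\
      ~ meager (phi @` (E `&` BP j) `&` (U `&` K i)).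
    apply: contrapT => none.
    have oUK : open (U `&` K i) by apply: openI => //; exact: open_heavy_part.
    have := @heavy_part_nonmeager _ (phi @` (E `&` B i)) _ oUK.
    apply; first by case: UK => z [Uz Kz]; exists z.
    apply: (@meagerS _ _ (\bigcup_(j in finer n i)
        (phi @` (E `&` BP j) `&` (U `&` K i)))); last first.
      apply: meager_bigcup => j fj.
      by apply: contrapT => nm'; apply: none; exists j.
    move=> _ [[e [Ee Be] <-] UKe].
    have [V [oV Ve clV smV]] : exists V,
        [/\ open V, V e, closure V `<=` B i `&` Q n & small n V].
      apply: small_nbhs; apply: open_nbhs_nbhs; split; first exact: openI.
      by split=> //; move: Ee; rewrite EQ; apply.
    have [j Bje BjV] := bBP e V (open_nbhs_nbhs (conj oV Ve)).
    exists j; last by split=> //; exists e.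
    split; last exact: small_sub smV.
    exact: subset_trans (closure_subset BjV) clV.
  have [z hz] := heavy_part_neq0 bBT nmj.
  have Kjz : K (Some j) z by apply: heavy_partS hz => w [].
  (* z is only in the closure of U; the open set K (Some j) meets U itself. *)
  have [w [[_ UKw] Kjw]] :
      (phi @` (E `&` BP j) `&` (U `&` K i)) `&` K (Some j) !=set0.
    apply: (heavy_part_closure hz); apply: open_nbhs_nbhs; split=> //.
    exact: open_heavy_part.
  exists w, ((U `&` K i) `&` K (Some j)); split.
  - apply: open_nbhs_nbhs; split=> //.
    apply: openI; last exact: open_heavy_part.
    by apply: openI => //; exact: open_heavy_part.
  - by move=> ? [[]].
  - by move=> y [_ Ky] [_]; apply; exists j.
apply: (@meagerS _ _ (\bigcup_(ni : nat * option I) N ni.1 ni.2)); last first.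
  by apply: meager_bigcup => ni _; exact: nowhere_dense_meager.
move=> x [hx nEx]; apply: contrapT => nNx; apply: nEx.
have KNone : K None x by rewrite /K /B setIT.
have [g gP] : exists g : nat -> option I -> option I, forall n i, K i x ->
    exists j, [/\ g n i = Some j, finer n i j & K (Some j) x].
  have /choice[g gP] : forall ni : nat * option I, exists o, K ni.2 x ->
      exists j, [/\ o = Some j, finer ni.1 ni.2 j & K (Some j) x].
    move=> [n i] /=; have [Kx|] := pselect (K i x); last by exists None.
    have [[j fj Kj]|nK] := pselect ((\bigcup_(j in finer n i) K (Some j)) x).
      by exists (Some j) => _; exists j.
    by exfalso; apply: nNx; exists (n, i).
  by exists (fun n i => g (n, i)) => n i; apply: (gP (n, i)).
pose s := fix s n := if n is m.+1 then g m (s m) else None.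
have Ks n : K (s n) x.
  by elim: n => [//|n IH] /=; have [j [-> _]] := gP n _ IH.
have sfin n : closure (B (s n.+1)) `<=` B (s n) `&` Q n /\ small n (B (s n.+1)).
  by have [j [/= -> ? _]] := gP n _ (Ks n).
have [p pP] : exists p : P, forall U, nbhs p U -> exists n, B (s n.+1) `<=` U.
  apply: small_cvg => n; last by have [] := sfin n.
  - have /(_ setT filterT)[_ [[e [_ Be] _] _]] := clK _ _ (Ks n.+1).
    by exists e.
  - have [h _] := sfin n.+1.
    by move=> z /(@subset_closure _ _)/h[].
have sdec : forall n m, (n <= m)%N -> B (s m) `<=` B (s n).
  apply: decreasing_setsP => n z /(@subset_closure _ _) cz.
  by have [/(_ z cz)[]] := sfin n.
have Ep : E p.
  rewrite EQ => n _; have [h _] := sfin n; apply: (h p _).2 => U /pP[m BU].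
  have /(_ setT filterT)[_ [[e [_ Be] _] _]] := clK _ _ (Ks (n.+1 + m.+1)%N).
  exists e; split; first by apply: sdec Be; exact: leq_addr.
  by apply: BU; apply: sdec Be; exact: leq_addl.
exists p => //; apply: hT => A C Ap Cx.
have [n BA] := pP _ (cphi _ _ Ap).
have [_ [[e [_ Be] <-] Ce]] := clK _ _ (Ks n.+1) C Cx.
by exists (phi e); split=> //; exact: BA.
Qed.

(** * Polish spaces *)

Lemma inv_nat_lt (R : realType) (e : R) :
  0 < e -> exists n : nat, n.+1%:R^-1 < e.
Proof.
move=> e0; have [n _ /(_ n (leqnn n)) ne] := near_infty_natSinv_lt (PosNum e0).
by exists n.
Qed.

(** X, with its metric pulled back from a complete metric space, and the space
    of maps into X, with uniform distance, are treated alike: [close_to x e]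
    is the ball of radius e around x. *)
Section uniform_sieve.
Context {R : realType} {T : topologicalType}.
Variable close_to : T -> R -> T -> Prop.
Hypothesis close_sym : forall x e y, close_to x e y -> close_to y e x.
Hypothesis close_split : forall z x e y,
  close_to x (e / 2) z -> close_to z (e / 2) y -> close_to x e y.
Hypothesis close_le : forall x d e y,
  d <= e -> close_to x d y -> close_to x e y.
Hypothesis nbhs_close : forall x e, 0 < e -> nbhs x (close_to x e).
Hypothesis nbhs_closeP : forall x U,
  nbhs x U -> exists2 e, 0 < e & close_to x e `<=` U.
Hypothesis close_complete : forall v : nat -> T,
  (forall n k l, (n <= k)%N -> (n <= l)%N -> close_to (v k) n.+1%:R^-1 (v l)) ->
  exists x, forall e, 0 < e ->
    exists n, forall k, (n <= k)%N -> close_to x e (v k).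

Lemma uniform_sieve_complete : sieve_complete T.
Proof.
exists (fun n V => forall x y, V x -> V y -> close_to x n.+1%:R^-1 y).
split.
- by move=> n V W WV sV x y /WV Vx /WV Vy; exact: sV.
- move=> n x U Ux; have [e e0 eU] := nbhs_closeP Ux.
  pose r := Num.min (e / 2) (n.+1%:R^-1 / 2).
  have r0 : 0 < r by rewrite lt_min !divr_gt0.
  have Vr y : interior (close_to x r) y -> close_to x r y.
    by move/interior_subset.
  exists (interior (close_to x r)); split.
  + exact: open_interior.
  + exact: nbhs_close.
  + move=> y cy; apply: eU.
    have e20 : 0 < e / 2 by rewrite divr_gt0.
    have [z [/Vr xz yz]] := cy _ (nbhs_close y e20).
    apply: (close_split (z := z)); last exact: close_sym.
    by apply: close_le xz; rewrite ge_min lexx.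
  + move=> y z /Vr xy /Vr xz; apply: (close_split (z := x)); last first.
      by apply: close_le xz; rewrite ge_min lexx orbT.
    by apply: close_sym; apply: close_le xy; rewrite ge_min lexx orbT.
- move=> V V0 Vdec Vsm.
  have Vdecm := decreasing_setsP Vdec.
  have /choice[v Vv] := V0.
  have [|x xv] := close_complete (v := v).
    move=> n k l nk nl.
    by apply: Vsm; [exact: Vdecm nk _ _|exact: Vdecm nl _ _].
  exists x => U /nbhs_closeP[e e0 eU].
  have e20 : 0 < e / 2 by rewrite divr_gt0.
  have [n ne] := inv_nat_lt e20; have [k xvk] := xv _ e20.
  exists n => z Vz; apply: eU.
  apply: (close_split (z := v (maxn k n))).
    by apply: xvk; exact: leq_maxl.
  apply: close_le (ltW ne) _; apply: Vsm => //.
  by apply: Vdecm (Vv _); exact: leq_maxr.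
Qed.

End uniform_sieve.

Section polish_metric.
Context {R : realType} {X : topologicalType} {M : metricType R}.
Variables (h : X -> M) (g : M -> X).
Hypotheses (hK : cancel h g) (gK : cancel g h).
Hypotheses (ch : continuous h) (cg : continuous g).

Lemma nbhs_pullback_ball (x : X) (e : R) :
  0 < e -> nbhs x [set y | ball (h x) e (h y)].
Proof. by move=> e0; exact: (@ch x _ (nbhsx_ballx (h x) e e0)). Qed.

Lemma nbhs_pullbackP (x : X) (U : set X) :
  nbhs x U -> exists2 e : R, 0 < e & forall y, ball (h x) e (h y) -> U y.
Proof.
move=> Ux; have : nbhs (h x) (g @^-1` U) by apply: cg; rewrite hK.
by move=> /nbhs_ballP[e /= e0 eU]; exists e => // y /eU /=; rewrite hK.
Qed.

Lemma metrizable_hausdorff : hausdorff_space X.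
Proof.
move=> p q pq; rewrite -(hK p) -(hK q); congr g.
apply: metric_hausdorff => A B Ap Bq.
have [z [Az Bz]] := pq (h @^-1` A) (h @^-1` B) (@ch p _ Ap) (@ch q _ Bq).
by exists (h z).
Qed.

Lemma pullback_ball_complete : complete_uniform M -> forall v : nat -> X,
  (forall n k l, (n <= k)%N -> (n <= l)%N ->
    ball (h (v k)) (n.+1%:R^-1 : R) (h (v l))) ->
  exists x, forall e : R, 0 < e ->
    exists n, forall k, (n <= k)%N -> ball (h x) e (h (v k)).
Proof.
move=> cM v vC; have [|m mv] := cM ((h \o v) @ \oo) _.
  apply/cauchy_ballP => e e0; have [n ne] := inv_nat_lt e0.
  exists ([set y | exists2 k, (n <= k)%N & y = h (v k)],
          [set y | exists2 k, (n <= k)%N & y = h (v k)]).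
    by split; exists n => // k /= nk; exists k.
  move=> [_ _] [[k nk /= ->] [l nl /= ->]] /=.
  by apply: le_ball (ltW ne) _ _; exact: vC.
exists (g m) => e e0; have [n _ nv] := mv _ (nbhsx_ballx m e e0).
by exists n => k nk; rewrite gK; exact: (nv k nk).
Qed.

Lemma complete_metrizable_sieve : complete_uniform M -> sieve_complete X.
Proof.
move=> cM.
apply: (@uniform_sieve_complete R X (fun x e y => ball (h x) e (h y))).
- by move=> x e y; exact: ball_sym.
- by move=> z x e y; exact: ball_split.
- by move=> x d e y de; exact: le_ball.
- exact: nbhs_pullback_ball.
- exact: nbhs_pullbackP.
- exact: pullback_ball_complete.
Qed.

(** Balls of radius 1 / (n + 1) around a countable dense set; a dense point d
    is represented by its code so that the index type is countable. *)
Lemma separable_countable_base : separable X ->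
  exists (I : countType) (B : I -> set X), countable_base B.
Proof.
move=> [D /countable_injP[code codeI] dD].
pose N (d : X) n := interior [set y | ball (h d) (n.+1%:R^-1 : R) (h y)].
exists (nat * nat)%type, (fun i : nat * nat =>
  \bigcup_(d in [set d | D d /\ code d = i.1]) N d i.2).
split=> [i|x U /nbhs_pullbackP[e e0 eU]].
  by apply: bigcup_open => d _; exact: open_interior.
have [n ne] := @inv_nat_lt R (e / 2) (divr_gt0 e0 (ltr0Sn _ 1)).
have r0 : 0 < n.+1%:R^-1 / 2 :> R by rewrite divr_gt0.
have [||d [/interior_subset /= xd Dd]] :=
    dD (interior [set y | ball (h x) (n.+1%:R^-1 / 2) (h y)]).
- by exists x; exact: nbhs_pullback_ball.
- exact: open_interior.
exists (code d, n).
  exists d => //; apply: filterS (nbhs_pullback_ball x r0) => y /= xy.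
  exact: ball_splitr xd xy.
move=> y [d' /= [Dd' cd']]; have -> : d' = d.
  by apply: codeI; rewrite ?inE.
move=> /interior_subset /= dy; apply: eU.
apply: (ball_split (z := h d)); last exact: le_ball (ltW ne) _ dy.
apply: le_ball xd; apply: le_trans (ltW ne).
by rewrite ler_pdivrMr// ler_pMr ?invr_gt0// ler1n.
Qed.

End polish_metric.

Lemma polish_space (R : realType) (X : topologicalType) : polish R X ->
  [/\ sieve_complete X, hausdorff_space X &
      exists (I : countType) (B : I -> set X), countable_base B].
Proof.
move=> [sX [M [cM [h [g [hK gK ch cg]]]]]]; split.
- exact: complete_metrizable_sieve cM.
- exact: metrizable_hausdorff hK ch.
- exact: separable_countable_base hK ch cg sX.
Qed.

Lemma sieve_complete_prod (S T : topologicalType) :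
  sieve_complete S -> sieve_complete T -> sieve_complete (S * T)%type.
Proof.
move=> [sm1 [sub1 nb1 cv1]] [sm2 [sub2 nb2 cv2]].
exists (fun n V => sm1 n (fst @` V) /\ sm2 n (snd @` V)); split.
- move=> n V W WV [s1 s2]; split.
  + by apply: sub1 s1; exact: image_subset.
  + by apply: sub2 s2; exact: image_subset.
- move=> n [x y] U [[U1 U2] /= [U1x U2y] UU].
  have [V1 [oV1 V1x cl1 s1]] := nb1 n x U1 U1x.
  have [V2 [oV2 V2y cl2 s2]] := nb2 n y U2 U2y.
  exists (V1 `*` V2); split=> //.
  + rewrite openE => -[a b] [/= V1a V2b].
    by exists (V1, V2) => //; split; exact: open_nbhs_nbhs.
  + move=> [a b] cab; apply: UU; split=> /=.
      apply: cl1 => W Wa.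
      have [|[c d] [[/= V1c _] [/= Wc _]]] := cab (W `*` setT).
        by exists (W, setT) => //; split=> //; exact: filterT.
      by exists c.
    apply: cl2 => W Wb.
    have [|[c d] [[/= _ V2d] [/= _ Wd]]] := cab (setT `*` W).
      by exists (setT, W) => //; split=> //; exact: filterT.
    by exists d.
  + by split; [apply: sub1 s1|apply: sub2 s2] => _ [[a b] [/= ? ?] <-].
- move=> V V0 Vdec Vsm.
  have [|||x xV] := cv1 (fun n => fst @` V n).
  + by move=> n; have [p Vp] := V0 n; exists p.1; exists p.
  + by move=> n; exact: image_subset.
  + by move=> n; have [] := Vsm n.
  have [|||y yV] := cv2 (fun n => snd @` V n).
  + by move=> n; have [p Vp] := V0 n; exists p.2; exists p.
  + by move=> n; exact: image_subset.
  + by move=> n; have [] := Vsm n.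
  have Vdecm := decreasing_setsP Vdec.
  exists (x, y) => U [[U1 U2] /= [/xV[n nU] /yV[m mU]] UU].
  exists (n + m)%N => -[a b] Vab; apply: UU; split=> /=.
  + by apply: nU; exists (a, b) => //; apply: Vdecm Vab; exact: leq_addr.
  + by apply: mU; exists (a, b) => //; apply: Vdecm Vab; exact: leq_addl.
Qed.

Lemma countable_base_prod (S T : topologicalType) (I J : countType)
    (B : I -> set S) (C : J -> set T) :
  countable_base B -> countable_base C ->
  countable_base (fun ij : I * J => B ij.1 `*` C ij.2).
Proof.
move=> [oB bB] [oC bC]; split=> [[i j]|[x y] U [[U1 U2] /= [U1x U2y] UU]].
  rewrite openE => -[a b] [/= Ba Cb].
  by exists (B i, C j) => //; split=> /=; apply: open_nbhs_nbhs; split=> //.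
have [i Bx BU] := bB x U1 U1x; have [j Cy CU] := bC y U2 U2y.
by exists (i, j) => // -[a b] [/= /BU ? /CU ?]; apply: UU.
Qed.

(** * Category in topological Abelian groups *)

Lemma open_forall_seq (T : topologicalType) (K : eqType) (s : seq K)
    (F : K -> set T) :
  (forall k, open (F k)) -> open [set y | forall k, k \in s -> F k y].
Proof.
move=> oF; elim: s => [|k s IH].
  suff -> : [set y | forall k, k \in [::] -> F k y] = setT by exact: openT.
  by apply/seteqP; split.
have -> : [set y | forall k', k' \in k :: s -> F k' y] =
    F k `&` [set y | forall k, k \in s -> F k y].
  apply/seteqP; split=> [y h|y [Fk h] k']; last first.
    by rewrite inE => /predU1P[->|/h].
  split; first by apply: h; rewrite inE eqxx.
  by move=> k' ks; apply: h; rewrite inE ks orbT.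
exact: openI.
Qed.

Lemma GdeltaI_open (T : topologicalType) (A U : set T) :
  Gdelta A -> open U -> Gdelta (A `&` U).
Proof.
move=> [Q oQ ->] oU; exists (fun n => Q n `&` U) => [n|]; first exact: openI.
apply/seteqP; split=> [x [Qx Ux] n _|x QUx]; first by split=> //; exact: Qx.
by split=> [n _|]; [have [] := QUx n I|have [] := QUx 0%N I].
Qed.

Lemma GdeltaX (S T : topologicalType) (A : set S) (B : set T) :
  Gdelta A -> Gdelta B -> Gdelta (A `*` B).
Proof.
move=> [Q oQ ->] [W oW ->]; exists (fun n => Q n `*` W n) => [n|].
  rewrite openE => -[a b] [/= Qa Wb].
  by exists (Q n, W n) => //; split=> /=; apply: open_nbhs_nbhs; split=> //.
apply/seteqP; split=> [[x y] [/= Qx Wy] n _|[x y] QWxy].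
  by split; [exact: Qx|exact: Wy].
by split=> n _ /=; have [] := QWxy n I.
Qed.

Section topological_group.
Context {X : topologicalZmodType}.
Implicit Types (A U V W : set X) (x y v : X).

Lemma nbhs_addP x y U : nbhs (x + y) U ->
  exists V W, [/\ nbhs x V, nbhs y W & forall a b, V a -> W b -> U (a + b)].
Proof.
move=> /(@add_continuous X (x, y))[[V W] [/= Vx Wy] VWU].
by exists V, W; split=> // a b Va Wb; apply: (VWU (a, b)).
Qed.

Lemma nbhs_shift x v U : nbhs (x + v) U -> nbhs x [set y | U (y + v)].
Proof.
move=> /nbhs_addP[V [W [Vx Wv VWU]]]; apply: filterS Vx => y Vy.
by apply: VWU => //; exact: nbhs_singleton.
Qed.

Lemma nbhs_subP x y U : nbhs (x - y) U ->
  exists V W, [/\ nbhs x V, nbhs y W & forall a b, V a -> W b -> U (a - b)].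
Proof.
move=> /nbhs_addP[V [W [Vx Wy VWU]]].
exists V, (-%R @^-1` W); split=> //; first exact: (@opp_continuous X y _ Wy).
by move=> a b Va Wb; apply: VWU.
Qed.

Lemma nbhs0_shift x U : nbhs x U -> nbhs 0 [set v | U (x + v)].
Proof.
move=> Ux; have : nbhs (0 + x) U by rewrite add0r.
by move=> /nbhs_shift; apply: filterS => y /=; rewrite addrC.
Qed.

Lemma nbhs_unshift x U : nbhs 0 U -> nbhs x [set y | U (y - x)].
Proof. by move=> U0; apply: nbhs_shift; rewrite subrr. Qed.

Lemma open_shift v U : open U -> open [set y | U (y + v)].
Proof.
by rewrite !openE => oU y Uy; apply: nbhs_shift; exact: oU.
Qed.

Lemma sub_pair_continuous : continuous (fun z : X * X => z.1 - z.2).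
Proof.
move=> [x y] U /= /nbhs_subP[V [W [Vx Wy VWU]]].
by exists (V, W) => //= -[a b] [/= Va Wb]; exact: VWU.
Qed.

Lemma mulrn_continuous n : continuous (fun x : X => x *+ n).
Proof.
elim: n => [|n IH] x U.
  rewrite mulr0n => U0; apply: filterS (@filterT _ (nbhs x) _) => y _ /=.
  by rewrite mulr0n; exact: nbhs_singleton U0.
rewrite mulrS => /nbhs_addP[V [W [Vx Wy VWU]]].
apply: filterS (filterI Vx (IH x W Wy)) => y [Vy Wny] /=.
by rewrite mulrS; exact: VWU.
Qed.

Lemma meager_shift v A : meager A -> meager [set y | A (y + v)].
Proof.
have shift_cvg u : continuous (fun y : X => y + u).
  by move=> x U; exact: nbhs_shift.
exact: (meager_preimage (addrK v) (subrK v) (shift_cvg v) (shift_cvg (- v))).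
Qed.

Hypothesis completeX : sieve_complete X.

(** If v is small, then Q and Q + v meet in a nonempty open set, where Q is the
    heavy part of S; this set is not meager, so it has a point y with both y
    and y - v in S. *)
Lemma pettis (S : set X) : heavy_part S !=set0 ->
  meager (heavy_part S `\` S) -> nbhs 0 (diff_set S S).
Proof.
set Q := heavy_part S => -[x0 Qx0] mQS.
have oQ : open Q by exact: open_heavy_part.
have : nbhs (x0 - 0) Q by rewrite subr0; exact: open_nbhs_nbhs.
move=> /nbhs_subP[V [W [Vx0 W0 VWQ]]]; apply: filterS W0 => v Wv.
apply: contrapT => nSv.
have oQQ : open (Q `&` [set y | Q (y - v)]).
  by apply: openI => //; exact: open_shift.
apply: (baire completeX oQQ).
  by exists x0; split=> //=; apply: VWQ => //; exact: nbhs_singleton.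
apply: meagerS (meagerU mQS (meager_shift (- v) mQS)) => y [Qy Qyv].
have [Sy|nSy] := pselect (S y); last by left.
right; split=> // Syv; apply: nSv.
by exists y => //; exists (y - v) => //; rewrite opprB addrC subrK.
Qed.

Hypothesis hausdorffX : hausdorff_space X.
Context {I : countType} {B : I -> set X}.
Hypothesis baseX : countable_base B.

Lemma nonmeager_image_diff (P : topologicalType) (J : countType)
    (BP : J -> set P) (E : set P) (phi : P -> X) :
  sieve_complete P -> countable_base BP -> continuous phi -> Gdelta E ->
  ~ meager (phi @` E) -> nbhs 0 (diff_set (phi @` E) (phi @` E)).
Proof.
move=> cP bP cphi GE nm; apply: pettis; first exact: heavy_part_neq0 baseX nm.
exact: (heavy_part_image cP bP baseX).
Qed.

(** Open mapping theorem for doubling: countably many translates of V cover X,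
    so the image of V is not meager, and by [nonmeager_image_diff] the set
    2V - 2V = 2(V - V) is a neighborhood of 0. *)
Lemma doubling_open_at0 : ~ meager (range (fun x : X => x + x)) ->
  forall W, nbhs 0 W -> nbhs 0 [set w + w | w in W].
Proof.
move=> nm W W0.
have : nbhs (0 - 0) W by rewrite subr0.
move=> /nbhs_subP[V1 [V2 [V10 V20 VW]]].
pose V := interior (V1 `&` V2).
have V0 : nbhs 0 V by apply: nbhs_interior; exact: filterI.
pose dbl x : X := x + x.
have nmV : ~ meager (dbl @` V).
  apply: contra_not nm => mV.
  apply: (@meagerS _ _ (\bigcup_(i in [set i | meager (dbl @` B i)])
    (dbl @` B i))); last exact: meager_bigcup.
  move=> _ [x _ <-]; have [i Bix BiV] := baseX.2 x _ (nbhs_unshift x V0).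
  exists i; last by exists x.
  apply: meagerS (meager_shift (- dbl x) mV) => _ [y /BiV /= Vy <-].
  by exists (y - x) => //; rewrite /dbl opprD addrACA.
have cdbl : continuous dbl by move=> x; exact: (@mulrn_continuous 2 x).
have := nonmeager_image_diff completeX baseX cdbl
  (open_Gdelta (open_interior _)) nmV.
apply: filterS => _ [_ [a Va <-] [_ [b Vb <-] <-]].
exists (a - b); last by rewrite /dbl opprD addrACA.
by apply: VW; [have [] := interior_subset Va|have [] := interior_subset Vb].
Qed.

Lemma mulrn_pow2_open_at0 : ~ meager (range (fun x : X => x + x)) ->
  forall n W, nbhs 0 W -> nbhs 0 [set w *+ 2 ^ n | w in W].
Proof.
move=> nm n W W0; elim: n => [|n IH].
  by apply: filterS W0 => w Ww; exists w.
apply: filterS (doubling_open_at0 nm IH) => _ [_ [w Ww <-] <-].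
by exists w => //; rewrite -mulrnDr addnn -mul2n -expnS.
Qed.

(** The point p is a midpoint of two points b and c around which the differences
    of A are locally non-meager. If 2v = (b1 - c1) - (b2 - c2) with b1, b2 near
    b and c1, c2 near c, then a half q of b2 + c1 close to p exists because
    doubling is open, and q + v is a half of b1 + c2. *)
Lemma local_difference A : mid_convex A -> Gdelta A ->
  ~ meager (range (fun x : X => x + x)) -> ~ meager (diff_set A A) ->
  exists2 p, A p & forall W, nbhs 0 W ->
    nbhs 0 [set v | exists q, [/\ A q, W (q - p) & A (q + v)]].
Proof.
move=> midA GA nm2 nmA.
have [b [c [Ab Ac nmbc]]] : exists b c, [/\ A b, A c & forall V W,
    nbhs b V -> nbhs c W -> ~ meager (diff_set (A `&` V) (A `&` W))].
  apply: contrapT => none; apply: nmA.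
  pose D (ij : I * I) := diff_set (A `&` B ij.1) (A `&` B ij.2).
  apply: (@meagerS _ _ (\bigcup_(ij in [set ij | meager (D ij)]) D ij));
    last exact: meager_bigcup.
  move=> _ [b Ab [c Ac <-]].
  have [V [W [Vb Wc mVW]]] : exists V W,
      [/\ nbhs b V, nbhs c W & meager (diff_set (A `&` V) (A `&` W))].
    apply: contrapT => h; apply: none; exists b, c; split=> // V W Vb Wc m.
    by apply: h; exists V, W.
  have [i Bib BiV] := baseX.2 b V Vb; have [j Bjc BjW] := baseX.2 c W Wc.
  exists (i, j); last by exists b => //; exists c.
  apply: meagerS mVW => _ [x [Ax /BiV Vx] [y [Ay /BjW Wy] <-]].
  by exists x => //; exists y.
have [[p hp] hA] := midA b c Ab Ac.
exists p; first exact: hA.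
move=> W W0; have := nbhs_unshift (b + c) (doubling_open_at0 nm2 W0).
move=> /nbhs_addP[V1 [V2 [V1b V2c V12]]].
pose S := diff_set (A `&` interior V1) (A `&` interior V2).
have nS : nbhs 0 (diff_set S S).
  pose E := (A `&` interior V1) `*` (A `&` interior V2).
  pose phi (z : X * X) := z.1 - z.2.
  have SE : phi @` E = S.
    apply/seteqP; split=> [_ [[x y] [/= xE yE] <-]|_ [x xE [y yE <-]]].
      by exists x => //; exists y.
    by exists (x, y).
  rewrite -SE.
  apply: (nonmeager_image_diff (sieve_complete_prod completeX completeX)
    (countable_base_prod baseX baseX)).
  - exact: sub_pair_continuous.
  - by apply: GdeltaX; apply: GdeltaI_open => //; exact: open_interior.
  - by rewrite SE; apply: nmbc; exact: nbhs_interior.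
have : nbhs 0 [set v : X | diff_set S S (v *+ 2)].
  by apply: (@mulrn_continuous 2 0); rewrite mul0rn.
apply: filterS => v [_ [b1 [Ab1 _] [c1 [Ac1 V2c1] <-]]].
move=> [_ [b2 [Ab2 V1b2] [c2 [Ac2 _] <-]] /esym v2].
have [w Ww ww] := V12 b2 c1 (interior_subset V1b2) (interior_subset V2c1).
have pw : Defs.half (b2 + c1) (p + w).
  by rewrite /Defs.half /= addrACA hp ww addrC subrK.
exists (p + w); split; first exact: (midA b2 c1 Ab2 Ac1).2.
- by rewrite addrC addKr.
- apply: (midA b1 c2 Ab1 Ac2).2.
  rewrite /Defs.half /= addrACA pw -mulr2n v2 opprB.
  by rewrite [b1 - c1 + _]addrACA -opprD addrC [b2 + c1]addrC subrK.
Qed.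

(** * Translates that meet A in a prescribed sequence *)

Section room.
Context {A : set X} {p : X}.
Hypotheses (midA : mid_convex A) (Ap : A p).

(** In a vector space, the point a = (1 - 2^-n) e + 2^-n p with e in A has this
    property, since a + z = (1 - 2^-n) e + 2^-n (p + 2^n z). *)
Definition room (n : nat) (a : X) : Prop :=
  forall z, A (p + z *+ 2 ^ n) -> A (a + z).

Lemma room_in n a : room n a -> A a.
Proof. by move=> /(_ 0); rewrite mul0rn !addr0; exact. Qed.

Lemma room_center : room 0 p.
Proof. by move=> z; rewrite expn0 mulr1n. Qed.

(** Moving by z spends half of the room: p + 2^n (z + w) is a half of the sum
    of p + 2^(n+1) z and p + 2^(n+1) w. *)
Lemma roomS n a z : room n a -> A (p + z *+ 2 ^ n.+1) -> room n.+1 (a + z).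
Proof.
move=> ra Az w Aw; rewrite -addrA; apply: ra.
apply: (midA Az Aw).2; rewrite /Defs.half /= [RHS]addrACA -mulrnDl.
by rewrite addrACA -mulrnDr addnn -mul2n -expnS.
Qed.

Hypothesis GA : Gdelta A.
Hypothesis nm2 : ~ meager (range (fun x : X => x + x)).
Hypothesis localA : forall W, nbhs 0 W ->
    nbhs 0 [set v | exists q, [/\ A q, W (q - p) & A (q + v)]].

(** Round n extends the list d of parameters by some t near [sel d], and the
    translation b by a small z. Write v for f t - f (sel d). By
    [local_difference] the small vector 2^(n+1) v is (q + 2^(n+1) v) - q with
    both points in A and q near p, and z is such that 2^(n+1) z = q - p. Then
    [roomS] applies to the old points, moved by z, and to the new point, which
    is the point of [sel d] moved by z + v. *)
Lemma translate_containing_sequence (T : topologicalType) (f : T -> X) (t0 : T)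
    (sel : seq T -> T) (N : nat -> T -> set T) :
  continuous f -> (forall n t, nbhs t (N n t)) ->
  (forall d, t0 \in d -> sel d \in d) ->
  (forall d, limit_point setT (sel d)) ->
  exists (b : X) (d : nat -> seq T), [/\ d 0%N = [:: t0],
    forall n, exists t, [/\ d n.+1 = rcons (d n) t, t != sel (d n) &
      N n (sel (d n)) t] &
    forall n t, t \in d n -> A (b + f t)].
Proof.
move=> cf nN selin sellim; have [Q oQ AQ] := GA.
pose inv n V (d : seq T) := [/\ open V, size d = n.+1, t0 \in d,
  exists2 b, V b & forall t, t \in d -> room n (b + f t) &
  forall m t y, (m < n)%N -> t \in d -> V y -> Q m (y + f t)].
pose rel (d d' : seq T) := exists t, [/\ d' = rcons d t, t != sel d &
  N (size d).-1 (sel d) t].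
have [||b [V [d [invV d0 reld Vb _]]]] :=
    @sieve_strategy X (seq T) inv rel setT [:: t0] completeX.
- split=> //; [exact: openT|by rewrite inE|].
  exists (p - f t0) => // t; rewrite inE => /eqP ->; rewrite subrK.
  exact: room_center.
- move=> n V d [oV sd t0d [b Vb rb] VQ]; set s := sel d.
  have Z0 := nbhs0_shift (open_nbhs_nbhs (conj oV Vb)).
  have L := localA (mulrn_pow2_open_at0 nm2 n.+1 Z0).
  have : nbhs ((f s - f s) *+ 2 ^ n.+1)
      [set v | exists q, [/\ A q,
        [set w *+ 2 ^ n.+1 | w in [set z | V (b + z)]] (q - p) & A (q + v)]].
    by rewrite subrr mul0rn.
  move=> /mulrn_continuous/nbhs_shift/cf L'.
  have [t [ts _ [Nt [q [Aq [z Vz zq] Aqt]]]]] :=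
    sellim d _ (filterI (nN n s) L').
  have rb' t' : t' \in rcons d t -> room n.+1 (b + z + f t').
    rewrite mem_rcons inE => /predU1P[->|t'd].
      have -> : b + z + f t = b + f s + (z + (f t - f s)).
        by rewrite addrACA [f s + _]addrC subrK.
      apply: roomS; first exact: rb (selin d t0d).
      by rewrite mulrnDl zq addrA [p + _]addrC subrK.
    by rewrite addrAC; apply: roomS; [exact: rb|rewrite zq addrC subrK].
  (* The points b + z + f t' lie in A, hence in the open sets Q 0, ..., Q n; W
     keeps all later translations there. *)
  pose W := V `&` [set y | forall m, m \in iota 0 n.+1 ->
    forall t', t' \in rcons d t -> Q m (y + f t')].
  have oW : open W.
    apply: openI => //; apply: open_forall_seq => m.
    by apply: open_forall_seq => t'; exact: open_shift.
  exists (b + z), W, (rcons d t); split.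
  + apply: open_nbhs_nbhs; split=> //; split=> // m _ t' /rb'/room_in.
    by rewrite AQ; apply.
  + by move=> ? [].
  + by exists t; split=> //; rewrite sd.
  + move=> V' oV' V'bz /(subset_trans (@subset_closure _ _)) V'W.
    split=> //; first by rewrite size_rcons sd.
    * by rewrite mem_rcons inE t0d orbT.
    * by exists (b + z).
    * by move=> m t' y mn t'd /V'W[_]; apply=> //; rewrite mem_iota.
have dS n m t : t \in d n -> t \in d (n + m)%N.
  elim: m => [|m IH]; first by rewrite addn0.
  move=> /IH h; rewrite addnS; have [t' [-> _ _]] := reld (n + m)%N.
  by rewrite mem_rcons inE h orbT.
exists b, d; split=> //.
- move=> n; have [t [h1 h2 h3]] := reld n; exists t; split=> //.
  by have [_ sd _ _ _] := invV n; move: h3; rewrite sd.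
- move=> n t tn; rewrite AQ => m _.
  have [_ _ _ _ h] := invV (n + m.+1)%N; apply: h (Vb _).
  + by rewrite addnS ltnS leq_addl.
  + exact: dS.
Qed.

End room.

End topological_group.

(** * The Cantor space and the ordinal omega + 1 *)

(** Baire category inside the closure of D: the play follows D, stays in the
    open sets that define E, and avoids the n-th point of E at round n. *)
Lemma Gdelta_crowded_uncountable (T : topologicalType) (E D : set T) :
  sieve_complete T -> hausdorff_space T -> Gdelta E -> D `<=` E ->
  D !=set0 -> isolated D = set0 -> ~ countable E.
Proof.
move=> cT hT [Q oQ EQ] DE [d0 Dd0] iD /countable_injP[code codeI].
pose F n := [set e | E e /\ code e = n].
have oF n : open (~` F n).
  apply: closed_openC; have [[e [Ee en]]|F0] := pselect (F n !=set0).
    suff -> : F n = [set e].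
      exact/accessible_closed_set1/hausdorff_accessible.
    apply/seteqP; split=> [e' [Ee' e'n]|_ ->] //=.
    by apply: codeI; rewrite ?inE ?e'n ?en.
  suff -> : F n = set0 by exact: closed0.
  by rewrite -subset0 => e Fe; apply: F0; exists e.
pose inv n V (_ : unit) := [/\ open V, V `&` D !=set0 &
  forall m, (m < n)%N -> V `<=` Q m `&` ~` F m].
have [||y [V [d [invV _ _ Vy _]]]] :=
    @sieve_strategy T unit inv (fun _ _ => True) setT tt cT.
- by split=> //; [exact: openT|exists d0].
- move=> n V _ [oV [d [Vd Dd]] VQ].
  have [d' [Vd' Dd' nFd']] : exists d', [/\ V d', D d' & ~ F n d'].
    have [Fd|] := pselect (F n d); last by exists d.
    have : ~ isolated D d by rewrite iD.
    move=> /not_andP[|nV]; first by rewrite inE.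
    apply: contrapT => none; apply: nV; exists V.
      exact: open_nbhs_nbhs.
    apply/seteqP; split=> [d' [Vd' Dd']|_ -> //] /=.
    apply: contrapT => dd'; apply: none; exists d'; split=> // -[Ed' nd'].
    apply: dd'; apply: codeI; rewrite ?inE; [exact: DE|exact: DE|].
    by rewrite nd' Fd.2.
  exists d', (V `&` (Q n `&` ~` F n)), tt; split=> //.
  + apply: open_nbhs_nbhs; split; first by apply: openI => //; exact: openI.
    by split=> //; split=> //; move: (DE _ Dd'); rewrite EQ; exact.
  + move=> V' oV' V'd' /(subset_trans (@subset_closure _ _)) V'W.
    split=> //; first by exists d'.
    move=> m; rewrite ltnS leq_eqVlt => /predU1P[->|mn] z /V'W[Vz] //.
    by move=> _; exact: VQ mn _ Vz.
have Ey : E y.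
  by rewrite EQ => n _; have [_ _ /(_ n (ltnSn n) y (Vy _))[]] := invV n.+1.
by have [_ _ /(_ _ (ltnSn (code y)) y (Vy _))[_]] := invV (code y).+1; apply.
Qed.

Section cantor.
Implicit Types (s t : cantor_space) (n : nat).

Definition cylinder n t : set cantor_space :=
  [set s | forall i, (i < n)%N -> s i = t i].

(** Coordinatewise convergence is easier to reach than the neighborhoods of the
    product topology; [nbhs_cylinderP] follows from it by contradiction. *)
Lemma cylinder_cvg (s : nat -> cantor_space) t :
  (forall n, cylinder n t (s n)) -> s @ \oo --> t.
Proof.
move=> st; apply/cvg_sup => i W [C [[V oV <-] Vt]] /filterS; apply.
by exists i.+1 => // n /= ni; rewrite /preimage /= (st n i ni).
Qed.

Lemma nbhs_cylinderP t (U : set cantor_space) :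
  nbhs t U -> exists n, cylinder n t `<=` U.
Proof.
move=> Ut; apply: contrapT => none.
have /choice[s sP] : forall n, exists s, cylinder n t s /\ ~ U s.
  move=> n; apply: contrapT => h; apply: none; exists n => s cs.
  by apply: contrapT => nUs; apply: h; exists s.
have [n _ nU] := @cylinder_cvg s t (fun n => (sP n).1) U Ut.
by apply: (sP n).2; exact: (nU n (leqnn n)).
Qed.

Lemma nbhs_cylinder n t : nbhs t (cylinder n t).
Proof.
have coord i : nbhs t [set s | s i = t i].
  have : nbhs (t i) [set t i] by [].
  by move=> /(@proj_continuous nat (fun=> bool) i t).
elim: n => [|n IH]; first by apply: filterS (@filterT _ (nbhs t) _).
apply: filterS (filterI IH (coord n)) => s [cs sn] i.
by rewrite ltnS leq_eqVlt => /predU1P[->|/cs].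
Qed.

Lemma cylinder_trans n s t u :
  cylinder n t s -> cylinder n s u -> cylinder n t u.
Proof. by move=> st us i ni; rewrite us// st. Qed.

Lemma cylinder_sym n s t : cylinder n t s -> cylinder n s t.
Proof. by move=> st i ni; rewrite st. Qed.

Lemma cylinder_le m n t : (m <= n)%N -> cylinder n t `<=` cylinder m t.
Proof. by move=> mn s st i im; apply: st; exact: leq_trans mn. Qed.

Lemma open_cylinder n t : open (cylinder n t).
Proof.
rewrite openE => s ts; apply: filterS (nbhs_cylinder n s) => u.
exact: cylinder_trans.
Qed.

Lemma closed_cylinder n t : closed (cylinder n t).
Proof.
move=> s /(_ _ (nbhs_cylinder n s))[u [tu su]].
exact: cylinder_trans tu (cylinder_sym su).
Qed.

Lemma cantor_sieve_complete : sieve_complete cantor_space.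
Proof.
exists (fun n V => forall s t, V s -> V t -> cylinder n s t); split.
- by move=> n V W WV sV s t /WV Vs /WV Vt; exact: sV.
- move=> n t U /nbhs_cylinderP[m mU]; exists (cylinder (maxn m n) t); split.
  + exact: open_cylinder.
  + by [].
  + move=> s /closed_cylinder ts; apply: mU; apply: cylinder_le ts.
    exact: leq_maxl.
  + move=> s u ts tu; apply: (@cylinder_le _ (maxn m n)); first exact: leq_maxr.
    exact: cylinder_trans (cylinder_sym ts) tu.
- move=> V V0 Vdec Vsm; have /choice[v Vv] := V0.
  have Vdecm := decreasing_setsP Vdec.
  exists (fun i => v i.+1 i : bool) => U /nbhs_cylinderP[n nU].
  exists n => s Vs; apply: nU => i ni.
  by apply: (Vsm i.+1) => //; exact: Vdecm ni _ Vs.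
Qed.

End cantor.

(** * Sets whose difference set is large *)

(** The exponent n in 2^n (x - a) = b - a is positive, so one factor 2 can be
    split off. *)
Lemma lr_mid_convex_double (X : topologicalZmodType) (A : set X) :
  lr_mid_convex A -> diff_set A A `<=` range (fun x : X => x + x).
Proof.
move=> [_ lrA] _ [b Ab [a Aa <-]].
have [|x _ [[//|n] _ xn]] := lrA a b Aa Ab A (@subset_refl _ A).
  by apply: filterS (@filterT _ (nbhs a) _).
exists ((x - a) *+ 2 ^ n) => //.
by rewrite -xn -mulrnDr addnn -mul2n -expnS.
Qed.

Lemma preimage_translateP (T : Type) (X : zmodType) (f : T -> X) (A : set X)
    b t :
  (f @^-1` translate A b) t <-> A (f t - b).
Proof.
split=> [[a Aa /= <-]|Aft]; first by rewrite addrK.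
by exists (f t - b) => //; rewrite subrK.
Qed.

Local Notation omega1 := (order_topology omega_succ).

Lemma lt_omega_some (m n : nat) : ((Some m : omega1) < Some n)%O = (m < n)%N.
Proof.
transitivity ((n != m) && (m <= n)%N); first by [].
by rewrite eq_sym ltn_neqAle.
Qed.

Lemma lt_omega_none (x : omega1) : ((None : omega1) < x)%O = false.
Proof. by case: x. Qed.

Lemma nbhs_omega (n : nat) : nbhs (None : omega1)
  [set s : omega1 | if s is Some m then (n <= m)%N else true].
Proof.
rewrite itv_nbhsE; exists (`]Some n, +oo[%O : interval omega1).
  by split=> //; rewrite in_itv.
by move=> [m|] //=; rewrite in_itv /= andbT lt_omega_some => /ltnW.
Qed.

Lemma nbhs_omega_finite (n : nat) :
  nbhs (Some n : omega1) [set Some n : omega1].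
Proof.
rewrite itv_nbhsE; case: n => [|n].
  exists (`]-oo, Some 1%N[%O : interval omega1).
    by split=> //; rewrite in_itv /= lt_omega_some.
  move=> [m|] /=; rewrite in_itv /= ?lt_omega_none// lt_omega_some.
  by case: m.
exists (`]Some n, Some n.+2[%O : interval omega1).
  by split=> //; rewrite in_itv /= !lt_omega_some !ltnSn.
move=> [m|] /=; rewrite in_itv /= ?lt_omega_none ?andbF// !lt_omega_some.
by rewrite ltnS -eqn_leq => /eqP ->.
Qed.

Lemma omega_limit_point : limit_point setT (None : omega1).
Proof.
move=> U; rewrite itv_nbhsE => -[[l u] [oi it0] iU].
have {oi it0} [m mi] : exists m : nat,
    (Some m : omega1) \in Interval l u.
  case: u oi it0 {iU} => [b x|b] oi; last first.
    rewrite (itv_open_ends_rinfty oi).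
    case: l oi => [b' [m|]|b'] oi.
    + rewrite (itv_open_ends_lside oi) => _; exists m.+1.
      by rewrite in_itv /= andbT lt_omega_some.
    + by rewrite (itv_open_ends_lside oi) in_itv.
    + by rewrite (itv_open_ends_linfty oi) => _; exists 0%N.
  rewrite (itv_open_ends_rside oi) in_itv /=.
  by rewrite lt_omega_none andbF.
by exists (Some m); split=> //; exact: iU.
Qed.

Section nonmeager.
Context {X : topologicalZmodType} {I : countType} {B : I -> set X} {A : set X}.
Hypotheses (completeX : sieve_complete X) (hausdorffX : hausdorff_space X).
Hypothesis baseX : countable_base B.
Hypotheses (lrA : lr_mid_convex A) (GA : Gdelta A).

Lemma nonmeager_local_difference : ~ meager (diff_set A A) ->
  ~ meager (range (fun x : X => x + x)) /\
  exists2 p, A p & forall W, nbhs 0 W ->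
    nbhs 0 [set v | exists q, [/\ A q, W (q - p) & A (q + v)]].
Proof.
move=> nmA; have nm2 : ~ meager (range (fun x : X => x + x)).
  by apply: contra_not nmA; exact/meagerS/lr_mid_convex_double.
split=> //.
exact: (local_difference completeX hausdorffX baseX lrA.1 GA nm2 nmA).
Qed.

Lemma nonmeager_diff_nbhs0 : ~ meager (diff_set A A) -> nbhs 0 (diff_set A A).
Proof.
move=> /nonmeager_local_difference[_ [p Ap localA]].
apply: filterS (localA setT filterT) => v [q [Aq _ Aqv]].
by exists (q + v) => //; exists q => //; rewrite addrC addKr.
Qed.

Hypothesis A0 : nbhs 0 (diff_set A A).

Lemma nbhs0_diff_translate (T : topologicalType) (f : T -> X) (t0 : T)
    (sel : seq T -> T) (N : nat -> T -> set T) :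
  continuous f -> (forall n t, nbhs t (N n t)) ->
  (forall d, t0 \in d -> sel d \in d) ->
  (forall d, limit_point setT (sel d)) ->
  exists (b : X) (d : nat -> seq T), [/\ d 0%N = [:: t0],
    forall n, exists t, [/\ d n.+1 = rcons (d n) t, t != sel (d n) &
      N n (sel (d n)) t] &
    forall n t, t \in d n -> (f @^-1` translate A b) t].
Proof.
have nmA : ~ meager (diff_set A A).
  move=> /(meagerS (@interior_subset _ _)).
  by apply: (baire completeX (open_interior _)); exists 0.
have [nm2 [p Ap localA]] := nonmeager_local_difference nmA.
move=> cf nN selin sellim.
have [b [d [d0 dS dA]]] := translate_containing_sequence completeX hausdorffX
  baseX lrA.1 Ap GA nm2 localA cf nN selin sellim.
exists (- b), d; split=> // n t /dA.
by rewrite addrC => h; apply/preimage_translateP; rewrite opprK.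
Qed.

(** The stage k + 1 of the construction approximates the parameter of index
    [logn 2 (k + 1)], so that every index is served infinitely often. *)
Lemma nbhs0_diff_crowded (f : cantor_space -> X) : continuous f ->
  exists b (D : set cantor_space),
    [/\ D `<=` f @^-1` translate A b, D !=set0 & isolated D = set0].
Proof.
move=> cf; pose t0 : cantor_space := fun=> false.
pose sel (d : seq cantor_space) := nth t0 d (logn 2 (size d)).
have [||b [d [d0 dS dA]]] :=
    @nbhs0_diff_translate _ f t0 sel cylinder cf nbhs_cylinder.
- move=> s t0s; apply: mem_nth; apply: ltn_logl.
  by case: s t0s.
- move=> s; have [_ /= ->] := cantor_perfect.
  by [].
pose D := [set t | exists n, t \in d n].
have sd n : size (d n) = n.+1.
  elim: n => [|n IH]; first by rewrite d0.
  by have [t [-> _ _]] := dS n; rewrite size_rcons IH.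
have nthS i n m : (i <= n)%N -> nth t0 (d (n + m)%N) i = nth t0 (d n) i.
  move=> iln; elim: m => [|m IH]; first by rewrite addn0.
  rewrite addnS; have [t [-> _ _]] := dS (n + m)%N.
  by rewrite nth_rcons sd ltnS (leq_trans iln (leq_addr _ _)).
exists b, D; split.
- by move=> t [n tn]; exact: dA tn.
- by exists t0, 0%N; rewrite d0 inE.
rewrite -subset0 => t [/[!inE] -[n tn] [V Vt VD]].
have [m mV] := nbhs_cylinderP Vt.
pose i := index t (d n).
have iln : (i <= n)%N by rewrite -ltnS -(sd n) index_mem.
(* k + 1 has 2-adic valuation i, and k is at least n + m. *)
pose k := (2 ^ i * (n + m).*2.+1).-1.
have kE : k.+1 = (2 ^ i * (n + m).*2.+1)%N.
  by rewrite /k prednK// muln_gt0 expn_gt0.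
have ki : logn 2 k.+1 = i.
  rewrite kE lognM ?expn_gt0// pfactorK// logn_coprime ?addn0//.
  by rewrite coprime2n /= odd_double.
have nmk : (n + m <= k)%N.
  rewrite -ltnS kE; apply: (@leq_trans (n + m).*2.+1).
    by rewrite ltnS -addnn leq_addr.
  by rewrite leq_pmull// expn_gt0.
have selk : sel (d k) = t.
  rewrite /sel sd ki -(subnKC (leq_trans (leq_addr m n) nmk)) nthS//.
  by rewrite nth_index.
have [u [dk1 ut ku]] := dS k; rewrite selk in ut ku.
suff : (V `&` D) u by rewrite VD => /= utE; move: ut; rewrite utE eqxx.
split.
  by apply: mV; apply: cylinder_le ku; exact: leq_trans (leq_addl _ _) nmk.
by exists k.+1; rewrite dk1 mem_rcons inE eqxx.
Qed.

Lemma nbhs0_diff_not_haar_scattered : ~ haar_scattered A.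
Proof.
move=> [f cf fS]; have [b [D [DA D0 iD]]] := nbhs0_diff_crowded cf.
by have := fS b D DA D0; rewrite iD => -[].
Qed.

Lemma nbhs0_diff_not_haar_countable : ~ haar_countable A.
Proof.
move=> [f cf fC]; have [b [D [DA D0 iD]]] := nbhs0_diff_crowded cf.
apply: Gdelta_crowded_uncountable cantor_sieve_complete _ _ DA D0 iD (fC b).
  exact: cantor_space_hausdorff.
have [Q oQ AQ] := GA; exists (fun n => f @^-1` [set x | Q n (x - b)]).
  by move=> n; apply: open_comp => [x _|]; [exact: cf|exact: open_shift].
apply/seteqP; split=> [t /preimage_translateP|t h].
  by rewrite AQ => h n _; exact: h.
by apply/preimage_translateP; rewrite AQ => n _; exact: h.
Qed.

(** The points t0 and t differ only at the coordinate n, chosen so late that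
    f t - f t0 = a - b with a, b in A; both are then sent by f into the
    translate of A by f t - a. *)
Lemma nbhs0_diff_not_haar_thin : ~ haar_thin A.
Proof.
move=> [f cf fT].
pose t0 : cantor_space := fun=> false.
have : nbhs t0 [set t | diff_set A A (f t - f t0)].
  by apply: (@cf t0 [set x | diff_set A A (x - f t0)]); exact: nbhs_unshift.
move=> /nbhs_cylinderP[n nA].
pose t : cantor_space := fun i => i == n.
have /nA[a Aa [b Ab abE]] : cylinder n t0 t.
  by move=> i ni; rewrite /t /t0 ltn_eqF.
have /(congr1 (fun s : cantor_space => s n)) : t = t0.
  apply: (fT (f t - a) n).
  - by rewrite inE; apply/preimage_translateP; rewrite opprB addrC subrK.
  - rewrite inE; apply/preimage_translateP.
    have -> : f t0 - (f t - a) = b; last by [].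
    apply/eqP; rewrite opprB addrCA -[f t0 - f t]opprB -abE opprB.
    by rewrite addrC subrK.
  - apply/funext => -[i ni].
    have in' : i != n by apply/eqP => E; have := set_mem ni; rewrite E; exact.
    by rewrite /sigL /= /t /t0 (negbTE in').
by rewrite /t /t0 eqxx.
Qed.

Lemma nbhs0_diff_not_null_finite : ~ null_finite A.
Proof.
move=> [f cf fF].
pose t0 : omega1 := None.
pose N (n : nat) (t : omega1) : set omega1 :=
  if t is Some _ then setT
  else [set s | if s is Some m then (n <= m)%N else true].
have [|||b [d [d0 dS dA]]] := @nbhs0_diff_translate _ f t0 (fun=> t0) N cf.
- by move=> n [m|]; [exact: filterT|exact: nbhs_omega].
- by [].
- by move=> _; exact: omega_limit_point.
(* The sum of the k + 1 is a crude common bound for the finitely many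
   finite ordinals k in the preimage. *)
have [n nP] : exists n : nat, forall m,
    (f @^-1` translate A b) (Some m) -> (m < n)%N.
  have /finite_seqP[s sE] := fF b.
  exists (\sum_(t <- s) if t is Some k then k.+1 else 0)%N => m /[!sE] /= ms.
  by rewrite (big_rem _ ms) /= leq_addr.
have [t [dE t0' Nt]] := dS n.
case: t => [m|//] in dE t0' Nt.
suff /nP : (f @^-1` translate A b) (Some m) by rewrite ltnNge Nt.
apply: (dA n.+1).
by rewrite dE mem_rcons inE eqxx.
Qed.

End nonmeager.

(** * The space of continuous maps *)

Section compact_open.
Import ArrowAsCompactOpen.
Context {R : realType} {X : topologicalType} {M : metricType R}.
Variables (h : X -> M) (g : M -> X).
Hypotheses (hK : cancel h g) (gK : cancel g h).
Hypotheses (ch : continuous h) (cg : continuous g).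
Local Notation C := (continuousType cantor_space X).

Lemma nbhs_image_compact (f : C) (K : set cantor_space) (V : set X) :
  compact K -> open V -> f @` K `<=` V ->
  nbhs f [set f' : C | (f' : cantor_space -> X) @` K `<=` V].
Proof.
move=> cK oV fKV.
have cid : continuous (id : C -> (cantor_space -> X)).
  exact: initial_continuous.
apply: (@cid f [set f' : cantor_space -> X | f' @` K `<=` V]).
by apply: open_nbhs_nbhs; split=> //; exact: compact_open_open.
Qed.

(** Joint continuity of evaluation, by compactness of cylinders. *)
Lemma near_eval (f : C) (t : cantor_space) (V : set X) : nbhs (f t) V ->
  \forall s \near t & f' \near f, V ((f' : C) s).
Proof.
move=> Vft.
have /nbhs_cylinderP[n nV] := @cts_fun _ _ f t _ (nbhs_interior Vft).
have cK : compact (cylinder n t).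
  apply: (@subclosed_compact _ _ setT) => //; first exact: closed_cylinder.
  exact: cantor_space_compact.
exists (cylinder n t, [set f' : C |
    (f' : cantor_space -> X) @` cylinder n t `<=` interior V]).
  split; first exact: nbhs_cylinder.
  apply: nbhs_image_compact => //; first exact: open_interior.
  by move=> _ [s /nV ? <-].
by move=> [s f'] [/= ts f'V]; apply: interior_subset; apply: f'V; exists s.
Qed.

Definition uniformly_near (f : C) (e : R) (f' : C) : Prop :=
  forall t : cantor_space, ball (h (f t)) e (h (f' t)).

Lemma nbhs_uniformly_near (f : C) (e : R) :
  0 < e -> nbhs f (uniformly_near f e).
Proof.
move=> e0; have e20 : 0 < e / 2 by rewrite divr_gt0.
have /compact_near_coveringP cpt := cantor_space_compact.
suff : \forall f' \near f, [set: cantor_space] `<=`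
    (fun t => ball (h (f t)) e (h ((f' : C) t))).
  by apply: filterS => f' ff' t; exact: ff'.
apply: (cpt C (nbhs f) (fun f' t => ball (h (f t)) e (h (f' t)))) => t _.
have ft := nbhs_pullback_ball ch (f t) e20.
have ft' : nbhs t [set s | ball (h (f t)) (e / 2) (h (f s))].
  exact: (@cts_fun _ _ f t _ ft).
have [[V W] [/= Vt Wf] VW] := near_eval ft.
exists (V `&` [set s | ball (h (f t)) (e / 2) (h (f s))], W).
  by split=> //; exact: filterI.
move=> [s f'] [/= [Vs ts] Wf']; apply: (ball_splitr ts).
exact: (VW (s, f')).
Qed.

Lemma nbhs_uniformly_nearP (f : C) (U : set C) : nbhs f U ->
  exists2 e : R, 0 < e & uniformly_near f e `<=` U.
Proof.
pose F : set_system (cantor_space -> X) := filter_from [set: nat]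
  (fun n => [set f' | forall t : cantor_space,
    ball (h (f t)) (n.+1%:R^-1 : R) (h (f' t))]).
have FF : Filter F.
  apply: filter_from_filter; first by exists 0%N.
  move=> i j _ _; exists (maxn i j) => // f' ff'; split=> t.
    by apply: le_ball (ff' t); rewrite lef_pV2 ?posrE// ler_nat ltnS leq_maxl.
  by apply: le_ball (ff' t); rewrite lef_pV2 ?posrE// ler_nat ltnS leq_maxr.
have Ff : {compact-open, F --> (f : cantor_space -> X)}.
  apply/compact_open_cvgP => K V cK oV fKV.
  have /compact_near_coveringP cpt := cK.
  have : \forall n \near \oo, K `<=` [set t : cantor_space | forall y,
      ball (h (f t)) (n.+1%:R^-1 : R) (h y) -> V y].
    apply: cpt => t Kt.
    have : nbhs (f t) V.
      by apply: open_nbhs_nbhs; split=> //; apply: fKV; exists t.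
    move=> /(nbhs_pullbackP hK cg)[e e0 eV].
    have e20 : 0 < e / 2 by rewrite divr_gt0.
    have ft := @cts_fun _ _ f t _ (nbhs_pullback_ball ch (f t) e20).
    have [n ne] := inv_nat_lt e20.
    exists ([set s | ball (h (f t)) (e / 2) (h (f s))], [set m | (n <= m)%N]).
      by split=> //=; exists n.
    move=> [s m] [/= ts nm] y sy; apply: eV; apply: ball_split ts _.
    apply: le_ball sy; apply: le_trans (ltW ne).
    by rewrite lef_pV2 ?posrE// ler_nat ltnS.
  move=> [n _ /(_ n (leqnn n)) nV]; exists n => // f' ff' _ [t Kt <-].
  exact: nV (ff' t).
move=> [W [[W' oW' <-] /= W'f] WU].
have [n _ nW] : F W' by apply: Ff; exact: open_nbhs_nbhs.
exists n.+1%:R^-1; first by rewrite invr_gt0.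
by move=> f' ff'; apply: WU; apply: nW.
Qed.

(** Uniform limits of continuous maps are continuous, and pointwise limits of
    uniformly Cauchy sequences are uniform. *)
Lemma compact_open_sieve_complete : complete_uniform M -> sieve_complete C.
Proof.
move=> cM; apply: (@uniform_sieve_complete R C uniformly_near).
- by move=> f1 e f2 f12 t; exact: ball_sym.
- by move=> f1 f2 e f3 f12 f23 t; exact: ball_split (f12 t) (f23 t).
- by move=> f1 d e f2 de f12 t; exact: le_ball de _ (f12 t).
- exact: nbhs_uniformly_near.
- exact: nbhs_uniformly_nearP.
move=> v vC.
have /choice[x xv] : forall t : cantor_space, exists x, forall e : R, 0 < e ->
    exists n, forall k, (n <= k)%N -> ball (h x) e (h (v k t)).
  by move=> t; apply: (pullback_ball_complete gK cM) => n k l nk nl; exact: vC.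
have unif e : 0 < e -> exists n, forall k, (n <= k)%N ->
    forall t, ball (h (x t)) e (h (v k t)).
  move=> e0; have e20 : 0 < e / 2 by rewrite divr_gt0.
  have [n ne] := inv_nat_lt e20; exists n => k nk t.
  have [m mP] := xv t _ e20.
  apply: (ball_split (mP (maxn m n) (leq_maxl _ _))).
  by apply: le_ball (ltW ne) _ _; apply: vC => //; exact: leq_maxr.
have cx : continuous x.
  move=> t U /(nbhs_pullbackP hK cg)[e e0 eU].
  have e20 : 0 < e / 2 by rewrite divr_gt0.
  have e40 : 0 < e / 2 / 2 by rewrite divr_gt0.
  have [n /(_ n (leqnn n)) xvn] := unif _ e40.
  have vt : nbhs t [set s | ball (h (v n t)) (e / 2 / 2) (h (v n s))].
    exact: (@cts_fun _ _ (v n) t _ (nbhs_pullback_ball ch (v n t) e40)).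
  apply: filterS vt => s /= vs; apply: eU.
  apply: (ball_split (ball_split (xvn t) vs)).
  apply: ball_sym; apply: le_ball (xvn s).
  by rewrite ler_pdivrMr// ler_pMr// ler1n.
by exists (mkcts cx : C) => e /unif[n nP]; exists n => k /nP.
Qed.

End compact_open.

(** The values z w are chosen one after another: each new one has to avoid
    finitely many translates of F and of - F, all of them meager. *)
Lemma avoid_differences (X : topologicalZmodType) (W : eqType) (ws : seq W)
    (U : W -> set X) (F : set X) :
  sieve_complete X -> meager F -> (forall w, open (U w)) ->
  (forall w, U w !=set0) ->
  exists z : W -> X, forall w, w \in ws ->
    U w (z w) /\ forall w', w' \in ws -> w' != w -> ~ F (z w - z w').
Proof.
move=> cX mF oU U0; elim: ws => [|w0 ws [z zP]]; first by exists (fun=> 0).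
have [w0ws|w0ws] := boolP (w0 \in ws).
  exists z => w; have ws_cons w' : (w' \in w0 :: ws) = (w' \in ws).
    by rewrite inE; case: eqVneq => // ->; rewrite w0ws.
  rewrite ws_cons => /zP[Uz zF]; split=> // w'.
  by rewrite ws_cons; exact: zF.
have mFl (a : X) : meager [set x | F (x - a)].
  exact: meager_shift.
have mFr (a : X) : meager [set x | F (a - x)].
  pose r x : X := a - x.
  have rK : cancel r r by move=> x; rewrite /r opprB addrC subrK.
  have cr : continuous r.
    move=> x V /nbhs_subP[V1 [V2 [V1a V2x V12]]].
    apply: filterS V2x => y V2y; apply: V12 => //; exact: nbhs_singleton.
  exact: (meager_preimage rK rK cr cr mF).
have [x Ux xF] : exists2 x, U w0 x &
    forall w, w \in ws -> ~ F (x - z w) /\ ~ F (z w - x).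
  apply: contrapT => none; apply: (baire cX (oU w0) (U0 w0)).
  apply: (@meagerS _ _ (\bigcup_k ([set x | F (x - z (nth w0 ws k))] `|`
      [set x | F (z (nth w0 ws k) - x)]))); last first.
    by apply: meager_bigcup => k _; apply: meagerU.
  move=> x Ux; apply: contrapT => nx; apply: none; exists x => // w wws.
  split=> Fx; apply: nx; exists (index w ws) => //; rewrite nth_index//.
    by left.
  by right.
exists (fun w => if w == w0 then x else z w) => w.
rewrite inE; case: eqVneq => [-> _|ww0 /= /[dup] wws /zP[Uz zF]].
  split=> // w'; rewrite inE => /predU1P[->|w'ws]; first by rewrite eqxx.
  by move=> w'w0; rewrite (negbTE w'w0); have [] := xF _ w'ws.
split=> // w'; rewrite inE; case: eqVneq => [_ _ _|_ /= w'ws]; last exact: zF.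
by have [] := xF _ wws.
Qed.

Section generic.
Import ArrowAsCompactOpen.
Context {R : realType} {X : topologicalZmodType} {M : metricType R}.
Variables (h : X -> M) (g : M -> X).
Hypotheses (hK : cancel h g) (gK : cancel g h).
Hypotheses (ch : continuous h) (cg : continuous g).
Hypothesis cM : complete_uniform M.
Local Notation C := (continuousType cantor_space X).

(** Different points s and t are separated by some cylinder length m, so a map
    two points of which share a translate of A clashes with A - A at some m. *)
Definition clash (m : nat) (F : set X) : set C :=
  [set f | exists s t, ~ cylinder m s t /\ F ((f : cantor_space -> X) s - f t)].

(** Compactness of the Cantor space, used once for s and once for t, makes the
    neighborhood of f uniform in s and t. *)
Lemma closed_clash m F : closed F -> closed (clash m F).
Proof.
move=> cF; rewrite -[clash m F]setCK.
apply: open_closedC; rewrite openE => f nf.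
have /compact_near_coveringP cpt := cantor_space_compact.
pose P (f' : C) s t :=
  ~ cylinder m s t -> ~ F ((f' : cantor_space -> X) s - f' t).
suff : \forall f' \near f,
    [set: cantor_space] `<=` (fun s => forall t, P f' s t).
  by apply: filterS => f' Pf' [s [t [/(Pf' s I t)]]].
apply: (cpt C (nbhs f) (fun f' s => forall t, P f' s t)) => s _.
suff : \forall i \near filter_prod (nbhs s) (nbhs f),
    [set: cantor_space] `<=` P i.2 i.1.
  by move=> [D D' DP]; exists D => // i /DP h' t; exact: h'.
apply: (cpt _ (filter_prod (nbhs s) (nbhs f)) (fun i t => P i.2 i.1 t)) => t _.
have [st|nst] := pselect (cylinder m s t).
  exists (cylinder m t, cylinder m s `*` setT).
    split; first exact: nbhs_cylinder.
    exists (cylinder m s, setT) => //; split; first exact: nbhs_cylinder.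
    exact: filterT.
  move=> [t' [s' f']] [/= tt' [ss' _]] []; apply: cylinder_trans tt'.
  by apply: cylinder_trans st; exact: cylinder_sym.
have : nbhs (f s - f t) (~` F).
  apply: open_nbhs_nbhs; split; first exact: closed_openC.
  by move=> Fst; apply: nf; exists s, t.
move=> /nbhs_subP[V [W [Vs Wt VW]]].
have [[S1 N1] [/= S1s N1f] SN1] := near_eval Vs.
have [[S2 N2] [/= S2t N2f] SN2] := near_eval Wt.
exists (S2, S1 `*` (N1 `&` N2)).
  by split=> //; exists (S1, N1 `&` N2) => //; split=> //; exact: filterI.
move=> [t' [s' f']] [/= St' [Ss' [N1f' N2f']]] _.
by apply: VW; [exact: (SN1 (s', f'))|exact: (SN2 (t', f'))].
Qed.

Lemma uniform_modulus (f : C) (e : R) m : 0 < e ->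
  exists2 n, (m <= n)%N & forall t s : cantor_space, cylinder n t s ->
    ball (h (f t)) e (h (f s)).
Proof.
move=> e0; have e20 : 0 < e / 2 by rewrite divr_gt0.
have /compact_near_coveringP cpt := cantor_space_compact.
have : \forall n \near \oo, [set: cantor_space] `<=` (fun t =>
    forall s, cylinder n t s -> ball (h (f t)) e (h (f s))).
  apply: (cpt _ \oo (fun n t => forall s, cylinder n t s ->
    ball (h (f t)) e (h (f s)))) => t _.
  have ft : nbhs t [set s | ball (h (f t)) (e / 2) (h (f s))].
    exact: (@cts_fun _ _ f t _ (nbhs_pullback_ball ch (f t) e20)).
  have [k kf] := nbhs_cylinderP ft.
  exists (cylinder k t, [set n | (k <= n)%N]).
    by split; [exact: nbhs_cylinder|exists k].
  move=> [t' n] [/= tt' kn] s t's; apply: (ball_splitr (kf _ tt')).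
  by apply: kf; apply: cylinder_trans tt' (cylinder_le kn t's).
move=> [n _ nP]; exists (maxn m n); first exact: leq_maxl.
by move=> t s ts; apply: (nP (maxn m n)) => //=; exact: leq_maxr.
Qed.

(** The approximation is constant on the cylinders of a length n on which f
    varies by less than e / 2; since n is at least m, points outside a common
    cylinder of length m get different codes, hence separated values. *)
Lemma approx_no_clash (f : C) (e : R) m F : 0 < e -> meager F ->
  exists2 f' : C, uniformly_near h f e f' & ~ clash m F f'.
Proof.
move=> e0 mF; have e20 : 0 < e / 2 by rewrite divr_gt0.
have [n mn nf] := uniform_modulus f m e20.
pose code (t : cantor_space) : n.-tuple bool := [tuple t i | i < n].
pose rep (w : n.-tuple bool) : cantor_space := fun i => nth false w i.
have repK t : cylinder n (rep (code t)) t.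
  by move=> i ni; rewrite /rep (nth_mktuple _ _ (Ordinal ni)).
have codeE s t : cylinder n s t -> code t = code s.
  move=> st; apply: eq_from_tnth => i; rewrite !tnth_mktuple.
  exact: st.
pose U w := interior [set x | ball (h (f (rep w))) (e / 2) (h x)].
have [|||z zP] := @avoid_differences X _ (enum {: n.-tuple bool}) U F _ mF.
- exact: (complete_metrizable_sieve hK gK ch cg cM).
- by move=> w; exact: open_interior.
- by move=> w; exists (f (rep w)); exact: nbhs_pullback_ball.
have cf' : continuous (z \o code : cantor_space -> X).
  move=> t V Vt; apply: filterS (nbhs_cylinder n t) => s /codeE /= cst.
  by rewrite /preimage /= cst; exact: nbhs_singleton Vt.
exists (mkcts cf' : C).
  move=> t; have [/interior_subset /= zt _] := zP (code t) (mem_enum _ _).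
  exact: ball_split (ball_sym (nf _ _ (repK t))) zt.
move=> [s [t [nst]]] /=.
have [_ zF] := zP (code s) (mem_enum _ _); apply: zF; first exact: mem_enum.
apply: contra_notN nst => /eqP cts; apply: (cylinder_le mn).
apply: cylinder_trans (repK t); rewrite cts.
exact: cylinder_sym.
Qed.

Lemma nowhere_dense_clash m F : nowhere_dense F -> nowhere_dense (clash m F).
Proof.
move=> ndF; set cF := closure F.
have mF : meager cF.
  apply: nowhere_dense_meager; rewrite /nowhere_dense.
  by have /closure_id <- : closed cF by exact: closed_closure.
apply/nowhere_denseP => U oU [f Uf].
have [e e0 eU] := nbhs_uniformly_nearP hK ch cg (open_nbhs_nbhs (conj oU Uf)).
have [f' /eU Uf' nf'] := approx_no_clash f m e0 mF.
exists f', (U `&` ~` clash m cF); split.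
- apply: open_nbhs_nbhs; split=> //; apply: openI => //.
  by apply: closed_openC; apply: closed_clash; exact: closed_closure.
- by move=> ? [].
- move=> f'' [_ nf''] [s [t [nst Fst]]]; apply: nf''; exists s, t.
  by split=> //; exact: subset_closure.
Qed.

Lemma meager_generically_haar1 (A : set X) :
  meager (diff_set A A) -> generically_haar1 A.
Proof.
move=> [F ndF AF].
apply: (@meagerS _ _ (\bigcup_(mn : nat * nat) clash mn.1 (F mn.2)));
  last first.
  apply: meager_bigcup => mn _; apply: nowhere_dense_meager.
  exact: nowhere_dense_clash.
move=> f /= /existsNP[x /existsNP[s /existsNP[t]]].
move=> /not_implyP[/preimage_translateP As].
move=> /not_implyP[/preimage_translateP At nst].
have [m nm] : exists m, ~ cylinder m s t.
  apply: contrapT => none; apply: nst; apply/funext => i.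
  apply: contrapT => nsti; apply: none; exists i.+1 => /(_ i (ltnSn i)).
  by move/esym.
have [|n _ Fst] := AF (f s - f t).
  exists (f s - x) => //; exists (f t - x) => //.
  by rewrite opprB addrA subrK.
by exists (m, n) => //; exists s, t.
Qed.

Lemma generically_haar1_exists (A : set X) : generically_haar1 A ->
  exists2 f : cantor_space -> X, continuous f &
    forall x, is_subset1 (f @^-1` translate A x).
Proof.
move=> GA; have cC := compact_open_sieve_complete hK gK ch cg cM.
apply: contrapT => none.
apply: (@baire C cC setT openT); first by exists (cst 0 : C).
apply: meagerS GA => f _ fA; apply: none; exists f => //.
exact: cts_fun.
Qed.

End generic.

(** * Maps with at most one point in each translate *)

Section haar1.
Context {X : topologicalZmodType} {A : set X}.
Hypothesis haar1A : exists2 f : cantor_space -> X, continuous f &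
    forall x, is_subset1 (f @^-1` translate A x).

Lemma haar1_thin : haar_thin A.
Proof.
have [f cf fA] := haar1A; exists f => // x n s t.
by rewrite !inE => As At _; exact: fA As At.
Qed.

Lemma haar1_scattered : haar_scattered A.
Proof.
have [f cf fA] := haar1A; exists f => // x S SA [s Ss].
exists s; split; first by rewrite inE.
exists setT; first exact: filterT.
rewrite setTI; apply/seteqP; split=> [t St|_ ->] //=.
by apply: (fA x); exact: SA.
Qed.

Lemma is_subset1_finite (T : Type) (S : set T) : is_subset1 S -> finite_set S.
Proof.
move=> S1; have [[s Ss]|S0] := pselect (S !=set0).
  suff -> : S = [set s] by exact: finite_set1.
  by apply/seteqP; split=> [t St|_ ->] //=; exact: S1.
suff -> : S = set0 by exact: finite_set0.
by rewrite -subset0 => s Ss; apply: S0; exists s.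
Qed.

Lemma haar1_countable : haar_countable A.
Proof.
have [f cf fA] := haar1A; exists f => // x.
exact/finite_set_countable/is_subset1_finite.
Qed.

Lemma haar1_null_finite : null_finite A.
Proof.
have [f cf fA] := haar1A.
pose q (t : order_topology omega_succ) : cantor_space :=
  fun i => if t is Some n then i == n else false.
(* q maps the ordinal n to the n-th unit vector and omega to 0. *)
have qI : injective q.
  move=> [n|] [m|] //.
  - move=> /(congr1 (fun s : cantor_space => s n)) /=.
    by rewrite /q eqxx => /esym/eqP ->.
  - by move=> /(congr1 (fun s : cantor_space => s n)); rewrite /q eqxx.
  - by move=> /(congr1 (fun s : cantor_space => s m)); rewrite /q eqxx.
have cq : continuous q.
  move=> [n|] U /= qU.
    by apply: filterS (nbhs_omega_finite n) => _ ->; exact: nbhs_singleton qU.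
  have [n nU] := nbhs_cylinderP qU.
  apply: filterS (nbhs_omega n) => -[m /= nm|_]; last exact: nbhs_singleton qU.
  by apply: nU => i ni; rewrite /q ltn_eqF// (leq_trans ni nm).
exists (f \o q).
  by move=> t; apply: continuous_comp; [exact: cq|exact: cf].
move=> x; apply: is_subset1_finite => s t As At; apply: qI.
exact: (fA x).
Qed.

End haar1.

(** * The equivalence *)

Theorem theorem19p15 (R : realType) (X : topologicalZmodType)
    (polishX : polish R X) (A : set X)
    (A_convex : lr_mid_convex A) (A_Gdelta : Gdelta A) :
  [<-> ~ nbhs (0 : X) (diff_set A A);
       meager (diff_set A A);
       generically_haar1 A;
       haar_thin A;
       null_finite A;
       haar_scattered A;
       haar_countable A].
Proof.
have [cX hX [I [B bB]]] := polish_space polishX.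
have [_ [M [cM [h [g [hK gK ch cg]]]]]] := polishX.
have not_nbhs_meager : ~ nbhs (0 : X) (diff_set A A) -> meager (diff_set A A).
  apply: contra_notP => nm.
  exact: (nonmeager_diff_nbhs0 cX hX bB A_convex A_Gdelta nm).
have generic : meager (diff_set A A) -> generically_haar1 A.
  exact: (meager_generically_haar1 hK gK ch cg cM).
have haar1 : ~ nbhs (0 : X) (diff_set A A) ->
    exists2 f : cantor_space -> X, continuous f &
      forall x, is_subset1 (f @^-1` translate A x).
  move=> /not_nbhs_meager/generic.
  exact: (generically_haar1_exists hK gK ch cg cM).
tfae.
- exact: not_nbhs_meager.
- exact: generic.
- by move=> /(generically_haar1_exists hK gK ch cg cM)/haar1_thin.
- move=> thinA; apply/haar1_null_finite/haar1 => A0.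
  exact: (nbhs0_diff_not_haar_thin A0 thinA).
- move=> nullA; apply/haar1_scattered/haar1 => A0.
  exact: (nbhs0_diff_not_null_finite cX hX bB A_convex A_Gdelta A0 nullA).
- move=> scatA; apply/haar1_countable/haar1 => A0.
  exact: (nbhs0_diff_not_haar_scattered cX hX bB A_convex A_Gdelta A0 scatA).
- move=> countA A0.
  exact: (nbhs0_diff_not_haar_countable cX hX bB A_convex A_Gdelta A0 countA).
Qed.
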